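(* Let $G=(V,E)$ be a finite simple graph of diameter $3$, and let $\ell(G)$ be the number of distinct lines of $G$. Then $\ell(G)<|V|$ if and only if $G$ is isomorphic to one of the following 14 graphs: $$G_a,\ G_b,\ G_c,\ G_d,\ M_{2,1,1},\ M_{3,1,1},\ M_{3,1,1,1},\ M_{3,2,1},\ M_{4,1,1,1,1},\ M_{4,2,1,1},\ M_{4,2,2},\ M_{4,3,1},\ M'_6,\ M'_8 .$$
   Context: Graphs are finite, simple and undirected. For a connected graph $G=(V,E)$, $d(x,y)$ is the minimum number of edges of a path joining $x$ and $y$, and the diameter is the maximum of $d(x,y)$ over $x,y\in V$ (in particular a graph of diameter $3$ is connected). For three distinct vertices, $[xzy]$ means $d(x,y)=d(x,z)+d(z,y)$. The line generated by distinct vertices $x,y$ is $$\overline{xy}=\{x,y\}\cup\{z\in V\setminus\{x,y\}: [zxy]\text{ or }[xzy]\text{ or }[xyz]\}.$$ $\mathcal{L}(G)=\{\overline{xy}: x,y\in V,\ x\neq y\}$ is the set of lines (as subsets of $V$) and $\ell(G)=|\mathcal{L}(G)|$. The graphs: each of $G_a,G_b,G_c,G_d$ has vertex set $\{1,2,3,4,5\}$. - $G_a$ has edges $12,13,24,34,45$ (a 4-cycle with a pendant vertex attached to one of its vertices). - $G_b$ has edges $12,13,23,24,34,45$ ($G_a$ plus the edge $23$). - $G_c$ has edges $12,13,23,34,45$ (a triangle with a pendant path of length 2 attached to one of its vertices). - $G_d$ has edges $12,13,14,45$ (a tree: a vertex $1$ with two leaf neighbours $2,3$ and a third neighbour $4$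 which is adjacent to the leaf $5$). For positive integers $p,p_1,\dots,p_q$ with $\sum_{i=1}^q p_i\le p$, $M_{p,p_1,\dots,p_q}$ is the graph obtained from pairwise vertex-disjoint complete graphs $K_p,K_{p_1},\dots,K_{p_q}$ by adding the edges of a matching of size $\sum_{i=1}^q p_i$ between $V(K_p)$ and $\bigcup_{i=1}^q V(K_{p_i})$ (so each vertex of each $K_{p_i}$ is matched to its own distinct vertex of $K_p$); there are no other edges. $M'_{2p}$ is the graph obtained from two vertex-disjoint copies of the complete graph $K_p$ by adding a matching of size $p-1$ between them. *)

(* Defs.v *)
From mathcomp Require Import all_boot.

Set Implicit Arguments.
Unset Strict Implicit.
Unset Printing Implicit Defensive.

Record sgraph := SGraph {
  vertex :> finType;
  edge : rel vertex;
  edge_sym : symmetric edge;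
  edge_irrefl : irreflexive edge }.

Definition isomorphic (G H : sgraph) : Prop :=
  exists2 f : G -> H, bijective f & forall x y, edge (f x) (f y) = edge x y.

Section Lines.
Variable G : sgraph.
Implicit Types x y z : G.

Definition has_path x y (n : nat) : bool :=
  [exists p : n.-tuple G, [&& path (@edge G) x p, uniq (x :: p) & last x p == y]].

(* The least n with has_path x y n.  Paths have fewer than #|G| edges, so
   nothing is lost by searching 0, ..., #|G|.-1 only; the value is #|G| when x
   and y are not connected. *)
Definition dist x y : nat := find (has_path x y) (iota 0 #|G|).

Definition connected_graph : Prop := forall x y, connect (@edge G) x y.

Definition has_diameter (k : nat) : Prop :=
  connected_graph /\ \max_(x : G) \max_(y : G) dist x y = k.

Definition between x z y : bool :=
  [&& x != z, z != y, x != y & dist x y == dist x z + dist z y].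

Definition line x y : {set G} :=
  [set x; y] :|: [set z | [|| between z x y, between x z y | between x y z]].

Definition lines : {set {set G}} := [set line p.1 p.2 | p : G * G & p.1 != p.2].

End Lines.

(* The vertex i : 'I_n carries the label i.+1, so that the labels occurring in
   the edge list s are 1, ..., n. *)
Section EdgeList.
Variables (n : nat) (s : seq (nat * nat)).

Definition edge_list_rel : rel 'I_n :=
  fun i j => (i != j) && (((i.+1, j.+1) \in s) || ((j.+1, i.+1) \in s)).

Lemma edge_list_sym : symmetric edge_list_rel.
Proof. by move=> i j; rewrite /edge_list_rel eq_sym orbC. Qed.

Lemma edge_list_irrefl : irreflexive edge_list_rel.
Proof. by move=> i; rewrite /edge_list_rel eqxx. Qed.

Definition edge_list_graph := SGraph edge_list_sym edge_list_irrefl.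
End EdgeList.

Definition Ga := edge_list_graph 5 [:: (1,2); (1,3); (2,4); (3,4); (4,5)].
Definition Gb := edge_list_graph 5 [:: (1,2); (1,3); (2,3); (2,4); (3,4); (4,5)].
Definition Gc := edge_list_graph 5 [:: (1,2); (1,3); (2,3); (3,4); (4,5)].
Definition Gd := edge_list_graph 5 [:: (1,2); (1,3); (1,4); (4,5)].

(* M p [:: p_1; ...; p_q], meant for positive p_i with p_1 + ... + p_q <= p.
   Vertices: inl a for a in K_p, and inr (i, j) for the j-th vertex of the
   i-th clique.  Since flatten_index ps i j = p_1 + ... + p_(i-1) + j (with i
   counted from 1 on the right), the small cliques are matched to consecutive
   disjoint blocks of K_p; any other matching gives an isomorphic graph. *)
Section CliqueMatching.
Variables (p : nat) (ps : seq nat).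

Definition M_vertex : finType :=
  ('I_p + {i : 'I_(size ps) & 'I_(nth 0 ps i)})%type.

Definition M_match (a : 'I_p) (u : {i : 'I_(size ps) & 'I_(nth 0 ps i)}) : bool :=
  a == flatten_index ps (tag u) (tagged u) :> nat.

Definition M_rel : rel M_vertex := fun x y =>
  match x, y with
  | inl a, inl b => a != b
  | inr u, inr v => (tag u == tag v) && (u != v)
  | inl a, inr u | inr u, inl a => M_match a u
  end.

Lemma M_sym : symmetric M_rel.
Proof. by case=> [a|u] [b|v] //=; rewrite eq_sym // [v == u]eq_sym. Qed.

Lemma M_irrefl : irreflexive M_rel.
Proof. by case=> [a|u] /=; rewrite !eqxx. Qed.

Definition M := SGraph M_sym M_irrefl.
End CliqueMatching.

(* M' p is the graph M'_{2p}: the index is the size of each clique, not the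
   number of vertices. *)
Section TwoCliques.
Variable p : nat.

Definition M'_rel : rel ('I_p + 'I_p)%type := fun x y =>
  match x, y with
  | inl a, inl b | inr a, inr b => a != b
  | inl a, inr b | inr b, inl a => (a == b) && (a < p.-1)
  end.

Lemma M'_sym : symmetric M'_rel.
Proof. by case=> [a|a] [b|b] //=; rewrite eq_sym. Qed.

Lemma M'_irrefl : irreflexive M'_rel.
Proof. by case=> [a|a] /=; rewrite eqxx. Qed.

Definition M' := SGraph M'_sym M'_irrefl.
End TwoCliques.

(* Main.v *)
(** The distance of a graph of diameter 3 is a metric with values in {1, 2, 3},
    and everything but the final identification of the exceptional graphs
    happens for such metrics.

    Main claim: a {1, 2, 3}-valued metric on n >= 9 points has at least n lines.
    For n <= 11 it follows from an enumeration of the spaces with at most 10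
    lines (there is none on 10 points), organised point by point because a
    subspace never has more lines than the whole space.  The same enumeration
    yields the exceptional graphs.

    For n >= 12 take a minimal counterexample A.  Deleting a set X of at most 3
    points destroys fewer than |X| lines, so among |X| distinct lines one is
    generated by two points outside X.  Suppose two pairs xy and xy' generate
    the same line.  Repeated use of the previous remark, with X contained in
    {x, y, y'}, refutes one by one the possible distance vectors from a further
    point to the points at hand, unless {d(x, y), d(x, y')} = {2, 3}; this is a
    finite case analysis.  By pigeonhole some line is generated by at least n/2
    pairs.  If two of these pairs meet, then all of them meet a fixed triple of
    points and there are too few of them.  Otherwise they form a perfect
    matching of A.  For two pairs zz' and ww' of the matching, one of the four
    pairs joining them generates a line that contains z, z', w, w' but no other
    pair of the matching entirely; this gives (n/2 choose 2) >= n lines. *)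
From HB Require Import structures.
Require Import Defs.
From mathcomp Require Import all_boot zify.
From Stdlib Require Import BinNums BinNat BinPos MSetPositive.

Set Implicit Arguments.
Unset Strict Implicit.
Unset Printing Implicit Defensive.

(** * Lines of {1, 2, 3}-valued metrics *)

(* Meant for the distances a, b, c <= 3 between three points of which two may
   coincide (then the two equal distances are positive). *)
Definition collinear (a b c : nat) : bool :=
  match a, b, c with
  | 0, _.+1, _.+1 | _.+1, 0, _.+1 | _.+1, _.+1, 0
  | 1, 1, 2 | 1, 2, 1 | 2, 1, 1
  | 1, 2, 3 | 1, 3, 2 | 2, 1, 3 | 2, 3, 1 | 3, 1, 2 | 3, 2, 1 => true
  | _, _, _ => false
  end.

(** Among distances in {1, 2, 3} the triangle inequality fails only for 1, 1, 3. *)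
Definition triangle (a b c : nat) : bool :=
  match a, b, c with
  | 1, 1, 3 | 1, 3, 1 | 3, 1, 1 => false
  | _, _, _ => true
  end.

Lemma collinearC a b c : collinear a b c = collinear b a c.
Proof.
by case: a => [|[|[|[|a]]]]; case: b => [|[|[|[|b]]]]; case: c => [|[|[|[|c]]]].
Qed.

Lemma collinearCA a b c : collinear a b c = collinear a c b.
Proof.
by case: a => [|[|[|[|a]]]]; case: b => [|[|[|[|b]]]]; case: c => [|[|[|[|c]]]].
Qed.

Fixpoint map2 A B C (f : A -> B -> C) s t : seq C :=
  match s, t with x :: s, y :: t => f x y :: map2 f s t | _, _ => [::] end.

Fixpoint all2b A B (f : A -> B -> bool) s t : bool :=
  match s, t with x :: s, y :: t => f x y && all2b f s t | _, _ => true end.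

Lemma map2_map (U A B C : Type) (f : A -> B -> C) (g : U -> A) (h : U -> B) s :
  map2 f (map g s) (map h s) = [seq f (g x) (h x) | x <- s].
Proof. by elim: s => //= x s ->. Qed.

Lemma all2b_map (U A B : Type) (f : A -> B -> bool) (g : U -> A) (h : U -> B) s :
  all2b f (map g s) (map h s) = all (fun x => f (g x) (h x)) s.
Proof. by elim: s => //= x s ->. Qed.

Definition metric3 (T : finType) (d : T -> T -> nat) : Prop :=
  [/\ forall x, d x x = 0, forall x y, d x y = d y x,
      forall x y, x != y -> d x y \in [:: 1; 2; 3] &
      forall x y z, triangle (d x y) (d x z) (d y z)].

Section Lines123.
Variables (T : finType) (d : T -> T -> nat).
Hypothesis d_metric : metric3 d.
Implicit Types (x y z : T) (A X : {set T}).

Let d0 x : d x x = 0. Proof. by case: d_metric. Qed.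
Let dC x y : d x y = d y x. Proof. by case: d_metric. Qed.
Let d13 x y : x != y -> d x y \in [:: 1; 2; 3].
Proof. by case: d_metric => _ _ H _; apply: H. Qed.
Let dtri x y z : triangle (d x y) (d x z) (d y z). Proof. by case: d_metric. Qed.

(** The cases of [collinear] with a distance 0 put x and y themselves on their line. *)
Definition ln x y : {set T} := [set z | collinear (d z x) (d z y) (d x y)].
Definition pairs A : {set T * T} := [set p | [&& p.1 \in A, p.2 \in A & p.1 != p.2]].
(* Lines of the subspace A are traces of lines of the whole space. *)
Definition trl A (p : T * T) : {set T} := ln p.1 p.2 :&: A.
Definition lns A : {set {set T}} := trl A @: pairs A.

Lemma in_ln x y z : (z \in ln x y) = collinear (d z x) (d z y) (d x y).
Proof. by rewrite inE. Qed.

Lemma lnC x y : ln x y = ln y x.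
Proof. by apply/setP=> z; rewrite !inE collinearC (dC x). Qed.

Lemma ln_l x y : x != y -> x \in ln x y.
Proof. by move=> xy; rewrite inE d0; move: (d13 xy); rewrite !inE => /or3P[] /eqP->. Qed.

Lemma ln_r x y : x != y -> y \in ln x y.
Proof. by move=> xy; rewrite lnC ln_l // eq_sym. Qed.

Lemma ln_rot x y z : (z \in ln x y) = (y \in ln x z).
Proof. by rewrite !inE (dC y x) (dC y z) (dC x z) collinearC collinearCA collinearC. Qed.

(** Intersecting the lines of A with B yields all lines of B, possibly among other sets. *)
Lemma lns_sub A (B : {set T}) : B \subset A -> #|lns B| <= #|lns A|.
Proof.
move=> sBA; apply: leq_trans (leq_imset_card (fun L => L :&: B) _).
apply: subset_leq_card; apply/subsetP => L /imsetP[p]; rewrite inE => /and3P[p1 p2 pN] ->.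
apply/imsetP; exists (trl A p); last by rewrite /trl -setIA (setIidPr sBA).
by apply: imset_f; rewrite inE pN !(subsetP sBA).
Qed.

(** No pair outside X generates a member of Q, so every line of [A :\: X] is the restriction of a
    line of A that is not in Q. *)
Lemma lns_setD A X (Q : {set {set T}}) :
  Q \subset lns A -> {in Q & pairs (A :\: X), forall L p, trl A p != L} ->
  #|lns (A :\: X)| + #|Q| <= #|lns A|.
Proof.
move=> sQ QX; rewrite -(cardsID Q (lns A)) (setIidPr sQ) addnC leq_add2l.
apply: leq_trans (leq_imset_card (fun L => L :\: X) _).
apply: subset_leq_card; apply/subsetP => L /imsetP[p pP ->].
apply/imsetP; exists (trl A p); last by rewrite /trl setIDA.
rewrite inE; apply/andP; split; first by apply/negP => /QX /(_ pP); rewrite eqxx.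
by apply: imset_f; move: pP; rewrite !inE => /and3P[/andP[_ ->] /andP[_ ->] ->].
Qed.

End Lines123.

(** * Certified case analysis *)

(* A certificate refutes a situation in which the distances between some points
   of a minimal counterexample A are known, together with a list S of the
   possible distance vectors from a further point of A to the known points.
   Stop: S is empty, although A has at least 12 points.
   Excl i c1 c2: by c1 no further point has the i-th vector of S; go on with c2.
   Fork X ls cs: there are at least |X| lines in ls, hence one of them is
   generated by two points outside X; cs treats the possible generating pairs. *)
Inductive cert :=
| Stop
| Excl of nat & cert & cert
| Fork of seq nat & seq (nat * nat) & seq cert.

Fixpoint cert_ind' (P : cert -> Prop) (PD : P Stop)
    (PE : forall i c1 c2, P c1 -> P c2 -> P (Excl i c1 c2))
    (PB : forall X ls cs, foldr and True (map P cs) -> P (Fork X ls cs)) c : P c :=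
  match c with
  | Stop => PD
  | Excl i c1 c2 => PE i c1 c2 (cert_ind' PD PE PB c1) (cert_ind' PD PE PB c2)
  | Fork X ls cs => PB X ls cs
      ((fix F cs : foldr and True (map P cs) :=
         match cs with
         | [::] => I
         | c :: cs => conj (cert_ind' PD PE PB c) (F cs)
         end) cs)
  end.

(** A line is described by its trace on the known points ([mtrace] for known points p and q,
    [vtrace] for a known point a and a further point with vector v) and by the vectors of the
    further points on it ([vin]). *)
Definition mget (M : seq (seq nat)) p q := nth 0 (nth [::] M p) q.
Definition mtrace M p q :=
  map2 (fun a b => collinear a b (mget M p q)) (nth [::] M p) (nth [::] M q).
Definition vin M (v : seq nat) p q := collinear (nth 0 v p) (nth 0 v q) (mget M p q).
Definition vtrace M v a :=
  map2 (fun b c => collinear b c (nth 0 v a)) v (nth [::] M a).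
Definition madd (M : seq (seq nat)) v := rcons (map2 rcons M v) (rcons v 0).
Definition vadd S v : seq (seq nat) :=
  flatten [seq [seq rcons u e | e <- [:: 1; 2; 3] & all2b (fun a b => triangle a b e) u v]
          | u <- S].
(** What remains possible once pq and ab are known to generate the same line. *)
Definition vfilter M (S : seq (seq nat)) p q a b :=
  [seq v <- S | vin M v p q == vin M v a b].

(* Distance matrix of the known points, possible vectors of further points. *)
Definition state := (seq (seq nat) * seq (seq nat))%type.
Definition sadd (s : state) v : state := (madd s.1 v, vadd s.2 v).
Definition sfilter (s : state) p q a b : state := (s.1, vfilter s.1 s.2 p q a b).

(** Unordered pairs with repetition: two further points may have the same distance vector. *)
Fixpoint upairs U (s : seq U) : seq (U * U) :=
  if s is x :: s' then [seq (x, y) | y <- s] ++ upairs s' else [::].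

(* The pair generating the line pq outside X consists of two, one or no known
   points. *)
Definition opts_old (s : state) (X : seq nat) p q : seq state :=
  let m := size s.1 in
  flatten [seq [seq sfilter s p q a b | b <- iota 0 m
                & [&& a < b, b \notin X & mtrace s.1 a b == mtrace s.1 p q]]
          | a <- iota 0 m & a \notin X].

Definition opts_one (s : state) (X : seq nat) p q : seq state :=
  let m := size s.1 in
  flatten [seq [seq sfilter (sadd s v) p q a m | v <- s.2
                & vin s.1 v p q && (vtrace s.1 v a == mtrace s.1 p q)]
          | a <- iota 0 m & a \notin X].

Definition opts_two (s : state) p q : seq state :=
  let m := size s.1 in
  flatten [seq [seq sfilter (sadd (sadd s vu.1) (rcons vu.2 e)) p q m m.+1
                | e <- [:: 1; 2; 3]
                & all2b (fun a b => triangle a b e) vu.2 vu.1 &&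
                  (map2 (fun a b => collinear a b e) vu.1 vu.2 == mtrace s.1 p q)]
          | vu <- upairs [seq v <- s.2 | vin s.1 v p q]].

Definition opts s X p q := opts_old s X p q ++ opts_one s X p q ++ opts_two s p q.

(** Distinct traces on the known points certify distinct lines. As X has at most 3 points, deleting
    it leaves at least 9 of the 12 or more points. *)
Definition branch_ok (s : state) (X : seq nat) (ls : seq (nat * nat)) :=
  let m := size s.1 in
  [&& size X <= size ls, 0 < size ls <= 3, all (ltn^~ m) X,
      all (fun l => [&& l.1 < m, l.2 < m & l.1 != l.2]) ls &
      uniq [seq mtrace s.1 l.1 l.2 | l <- ls]].

Fixpoint check (c : cert) (s : state) : bool :=
  match c with
  | Stop => (size s.1 < 12) && (s.2 == [::])
  | Excl i c1 c2 =>
      let v := nth [::] s.2 i in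
      check c1 (sadd s v) && check c2 (s.1, [seq u <- s.2 | u != v])
  | Fork X ls cs =>
      branch_ok s X ls &&
      (fix go cs (ss : seq state) {struct cs} :=
         match cs, ss with
         | [::], [::] => true
         | c :: cs, t :: ss => check c t && go cs ss
         | _, _ => false
         end) cs (flatten [seq opts s X l.1 l.2 | l <- ls])
  end.

(** * Soundness of certificates *)

Section Soundness.
Variables (T : finType) (d : T -> T -> nat).
Hypothesis d_metric : metric3 d.
Variable A : {set T}.
Hypothesis A12 : 12 <= #|A|.
(** The deletion property of a minimal counterexample, established in [few_private]. *)
Hypothesis A_gen : forall (X : {set T}) (ps : seq (T * T)),
  {subset ps <= pairs A} -> uniq [seq trl d A p | p <- ps] ->
  0 < size ps <= 3 -> #|X| <= size ps ->
  exists2 p, p \in ps & exists2 r, r \in pairs (A :\: X) & trl d A r = trl d A p.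

Let d0 x : d x x = 0. Proof. by case: d_metric. Qed.
Let dC x y : d x y = d y x. Proof. by case: d_metric. Qed.
Let d13 x y : x != y -> d x y \in [:: 1; 2; 3].
Proof. by case: d_metric => _ _ H _; apply: H. Qed.
Let dtri x y z : triangle (d x y) (d x z) (d y z). Proof. by case: d_metric. Qed.

Definition dmat (t : seq T) := [seq [seq d x y | y <- t] | x <- t].

Definition realizes (t : seq T) (s : state) :=
  [/\ uniq t, {subset t <= A}, s.1 = dmat t &
      forall z, z \in A -> z \notin t -> map (d z) t \in s.2].

Lemma size_dmat t : size (dmat t) = size t. Proof. by rewrite size_map. Qed.

Lemma nth_dmat x0 t p : p < size t -> nth [::] (dmat t) p = map (d (nth x0 t p)) t.
Proof. by move=> pt; rewrite (nth_map x0). Qed.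

Lemma mget_dmat x0 t p q : p < size t -> q < size t ->
  mget (dmat t) p q = d (nth x0 t p) (nth x0 t q).
Proof. by move=> pt qt; rewrite /mget (nth_dmat x0) // (nth_map x0). Qed.

Lemma mtrace_dmat x0 t p q : p < size t -> q < size t ->
  mtrace (dmat t) p q = [seq z \in ln d (nth x0 t p) (nth x0 t q) | z <- t].
Proof.
move=> pt qt; rewrite /mtrace (mget_dmat x0) // !(nth_dmat x0) // map2_map.
by apply: eq_map => z /=; rewrite in_ln !(dC z).
Qed.

Lemma vin_dmat x0 t z p q : p < size t -> q < size t ->
  vin (dmat t) (map (d z) t) p q = (z \in ln d (nth x0 t p) (nth x0 t q)).
Proof. by move=> pt qt; rewrite /vin (mget_dmat x0) // !(nth_map x0) // inE. Qed.

Lemma vtrace_dmat x0 t z a : a < size t ->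
  vtrace (dmat t) (map (d z) t) a = [seq w \in ln d z (nth x0 t a) | w <- t].
Proof.
move=> at_; rewrite /vtrace (nth_dmat x0) // (nth_map x0) // map2_map.
by apply: eq_map => w /=; rewrite in_ln !(dC w).
Qed.

Lemma madd_dmat t z : madd (dmat t) (map (d z) t) = dmat (rcons t z).
Proof.
rewrite /madd /dmat map_rcons map2_map; congr rcons; last by rewrite map_rcons d0.
by apply: eq_map => x; rewrite map_rcons (dC z).
Qed.

Lemma realizes_add t s z : realizes t s -> z \in A -> z \notin t ->
  realizes (rcons t z) (sadd s (map (d z) t)).
Proof.
case=> ut tA e1 e2 zA zt; split=> /=.
- by rewrite rcons_uniq zt.
- by move=> x; rewrite mem_rcons inE => /predU1P[->|/tA].
- by rewrite e1 madd_dmat.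
move=> w wA; rewrite mem_rcons inE negb_or => /andP[wz wt].
apply/flatten_mapP; exists (map (d w) t); first exact: e2.
rewrite map_rcons; apply: map_f; rewrite mem_filter d13 // andbT.
by rewrite all2b_map; apply/allP => x _; rewrite -[d w z]dC -(dC x z);
  move: (dtri x w z); rewrite (dC x w) (dC x z) (dC w z);
  case: (d w x) (d z x) (d z w) => [|[|[|[|a]]]] [|[|[|[|b]]]] [|[|[|[|c]]]].
Qed.

Lemma realizes_filter t s x0 p q a b : realizes t s ->
  p < size t -> q < size t -> a < size t -> b < size t ->
  trl d A (nth x0 t a, nth x0 t b) = trl d A (nth x0 t p, nth x0 t q) ->
  realizes t (sfilter s p q a b).
Proof.
case=> ut tA e1 e2 pt qt at_ bt etr; split=> //= z zA zt.
rewrite mem_filter e2 // andbT e1 !(vin_dmat x0) //.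
by have /setP/(_ z) := etr; rewrite !(inE, zA) !andbT => ->.
Qed.

Lemma upairsP (U : eqType) (s : seq U) x y : x \in s -> y \in s ->
  (x, y) \in upairs s \/ (y, x) \in upairs s.
Proof.
elim: s => // z s IH.
have E p : p \in [seq (z, y) | y <- z :: s] ++ upairs s -> p \in upairs (z :: s) by [].
have H u w : u = z -> w \in z :: s -> (u, w) \in upairs (z :: s).
  by move=> -> ws; apply: E; rewrite mem_cat map_f.
case: (eqVneq x z) => [xz|nx] xs ys; first by left; apply: H.
case: (eqVneq y z) => [yz|ny]; first by right; apply: H.
move: xs ys; rewrite !inE (negPf nx) (negPf ny) /= => xs ys.
by case: (IH xs ys) => K; [left|right]; apply: E; rewrite mem_cat K orbT.
Qed.

Lemma trace_eq (t : seq T) (P Q : {set T}) : {subset t <= A} -> P :&: A = Q :&: A ->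
  [seq z \in P | z <- t] = [seq z \in Q | z <- t].
Proof.
move=> tA /setP e; apply/eq_in_map => z /tA zA.
by have := e z; rewrite !inE zA !andbT.
Qed.

Lemma opts_complete x0 t s (X : seq nat) p q a b : realizes t s ->
  all (ltn^~ (size t)) X -> p < size t -> q < size t -> p != q ->
  (a, b) \in pairs (A :\: [set x in [seq nth x0 t i | i <- X]]) ->
  trl d A (a, b) = trl d A (nth x0 t p, nth x0 t q) ->
  exists2 s', s' \in opts s X p q & exists t', realizes t' s'.
Proof.
move=> rt Xt pt qt pq; have [ut tA e1 e2] := rt.
rewrite !inE /= -!andbA => /and5P[aX aA bX bA ab] etr.
set P := nth x0 t p in etr *; set Q := nth x0 t q in etr *.
have PQ : P != Q by rewrite nth_uniq.
have inPQ z : z \in A -> z \in ln d a b -> z \in ln d P Q.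
  by move=> zA zl; have /setP/(_ z) := etr; rewrite !inE /= zA !andbT => <-; move: zl;
    rewrite inE.
have aPQ : a \in ln d P Q by apply: inPQ => //; apply: ln_l.
have bPQ : b \in ln d P Q by apply: inPQ => //; apply: ln_r.
have notX i : i < size t -> nth x0 t i \notin [seq nth x0 t i | i <- X] -> i \notin X.
  by move=> it; apply: contra => iX; apply: map_f.
have st : size s.1 = size t by rewrite e1 size_dmat.
(* The options list an unordered pair in one order only: by index in t, known point first, or as in
   [upairs]. So a and b may have to be exchanged. *)
wlog ord : a b aX aA bX bA ab etr inPQ aPQ bPQ / (a \in t) &&
  ((b \notin t) || (index a t < index b t)) \/
   (a \notin t) && (b \notin t) && ((map (d a) t,
     map (d b) t) \in upairs [seq v <- s.2 | vin s.1 v p q]).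
  move=> W.
  have W1 := W a b aX aA bX bA ab etr inPQ aPQ bPQ.
  have etr' : trl d A (b, a) = trl d A (P, Q) by rewrite -etr /trl /= lnC.
  have ba : b != a by rewrite eq_sym.
  have inPQ' z : z \in A -> z \in ln d b a -> z \in ln d P Q by rewrite lnC //; apply: inPQ.
  have W2 := W b a bX bA aX aA ba etr' inPQ' bPQ aPQ.
  case at_: (a \in t); case bt: (b \in t).
  - case: (ltngtP (index a t) (index b t)) => [lt|gt|/eqP].
    + by apply: W1; left; rewrite at_ lt orbT.
    + by apply: W2; left; rewrite bt gt orbT.
    + move=> /eqP ei; move: ab; rewrite -(nth_index x0 at_) ei nth_index //.
      by rewrite eqxx.
  - by apply: W1; left; rewrite at_ bt.
  - by apply: W2; left; rewrite at_ bt.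
  have va : map (d a) t \in [seq v <- s.2 | vin s.1 v p q].
    by rewrite mem_filter e2 ?at_ // e1 (vin_dmat x0) // aPQ.
  have vb : map (d b) t \in [seq v <- s.2 | vin s.1 v p q].
    by rewrite mem_filter e2 ?bt // e1 (vin_dmat x0) // bPQ.
  by case: (upairsP va vb) => H; [apply: W1|apply: W2]; right; rewrite at_ bt H.
case: ord => [/andP[at_]|/andP[/andP[at_ bt] H]].
  set i := index a t; have it : i < size t by rewrite index_mem.
  have ai : a = nth x0 t i by rewrite nth_index.
  have iX : i \notin X by apply: notX => //; rewrite -ai.
  case bt: (b \in t) => /=.
  - move=> lt.
    set j := index b t; have jt : j < size t by rewrite index_mem.
    have bj : b = nth x0 t j by rewrite nth_index.
    have jX : j \notin X by apply: notX => //; rewrite -bj.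
    exists (sfilter s p q i j); last first.
      by exists t; apply: (realizes_filter (x0 := x0)) => //; rewrite -ai -bj.
    rewrite /opts mem_cat; apply/orP; left; rewrite /opts_old.
    apply/flatten_mapP; exists i; first by rewrite mem_filter iX mem_iota /= st.
    apply/mapP; exists j => //; rewrite mem_filter mem_iota /= st jt andbT jX lt /=.
    by rewrite e1 !(mtrace_dmat x0) // -ai -bj; apply/eqP; apply: trace_eq.
  - move=> _; set v := map (d b) t.
  exists (sfilter (sadd s v) p q i (size t)).
    rewrite /opts !mem_cat; apply/orP; right; apply/orP; left; rewrite /opts_one.
    apply/flatten_mapP; exists i; first by rewrite mem_filter iX mem_iota /= st.
    rewrite st; apply: map_f; rewrite mem_filter e2 ?bt // andbT e1 (vin_dmat x0) // bPQ /=.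
    rewrite (mtrace_dmat x0) // (vtrace_dmat x0) // -ai; apply/eqP; apply: trace_eq => //.
    by rewrite lnC.
  exists (rcons t b); apply: (realizes_filter (x0 := x0)).
  - by apply: realizes_add; rewrite ?bt.
  all: rewrite ?size_rcons ?ltnS ?(ltnW pt) ?(ltnW qt) ?(ltnW it) //.
  by rewrite !nth_rcons it pt qt ltnn eqxx -ai.
set v := map (d a) t in H; set u := map (d b) t in H.
have bt' : b \notin rcons t a by rewrite mem_rcons inE negb_or eq_sym ab.
exists (sfilter (sadd (sadd s v) (rcons u (d b a))) p q (size t) (size t).+1).
  rewrite /opts !mem_cat; apply/orP; right; apply/orP; right; rewrite /opts_two.
  apply/flatten_mapP; exists (v, u) => //.
  rewrite st; apply/mapP; exists (d b a) => //.
  rewrite mem_filter d13 1?eq_sym // andbT.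
  apply/andP; split.
    rewrite /v /u all2b_map; apply/allP => x _.
    by move: (dtri x b a); rewrite !(dC x).
  rewrite /v /u map2_map e1 (mtrace_dmat x0) //; apply/eqP.
  rewrite -/P -/Q -(@trace_eq t (ln d a b) (ln d P Q) tA etr).
  by apply: eq_map => z; rewrite in_ln !(dC z) (dC b a).
exists (rcons (rcons t a) b); apply: (realizes_filter (x0 := x0)).
- rewrite -map_rcons; apply: realizes_add => //.
  by apply: realizes_add.
all: rewrite ?size_rcons ?(leqW (leqW pt)) ?(leqW (leqW qt)) ?ltnS //.
by rewrite !nth_rcons !size_rcons !ltnS leqnn (ltnW pt) (ltnW qt) pt qt !(ltnn, eqxx).
Qed.

(** Induction on the certificate. [Stop] would leave A within fewer than 12 known points; a point
    with an excluded vector would extend t; in [Fork] the deletion property yields a realized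
    option. *)
Theorem check_sound c t s : realizes t s -> check c s -> False.
Proof.
elim/cert_ind': c t s => [|i c1 c2 IH1 IH2|X ls cs IH] t s rt.
- case: rt => ut tA e1 e2 /= /andP[+ /eqP s2]; rewrite e1 size_dmat => st.
  have : ~~ (A \subset [set x in t]).
    apply: contraTN st => /subset_leq_card; rewrite cardsE (card_uniqP ut) => H.
    by rewrite -leqNgt (leq_trans A12).
  by case/subsetPn => z zA; rewrite inE => zt; have := e2 z zA zt; rewrite s2.
- case/andP => k1 k2; set v := nth _ _ _ in k1 k2.
  apply: (IH2 t _ _ k2); have [ut tA e1 e2] := rt; split=> //= z zA zt.
  rewrite mem_filter e2 // andbT; apply/eqP => vE.
  by apply: (IH1 _ _ _ k1); rewrite -vE; apply: realizes_add.
case/andP => /and5P[sX /andP[ls0 ls3] Xt lst ult] /=.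
have [ut tA e1 e2] := rt.
have st : size s.1 = size t by rewrite e1 size_dmat.
have [x0 x0t] : exists x0, x0 \in t.
  case: ls ls0 lst {sX ls3 ult} => //= l ls _ /andP[/and3P[l1 _ _] _].
  by move: l1; rewrite st; case: t {rt ut tA e1 e2 st} => // x t _; exists x;
    rewrite inE eqxx.
pose f (l : nat * nat) := (nth x0 t l.1, nth x0 t l.2).
have lsP l : l \in ls -> [/\ l.1 < size t, l.2 < size t & l.1 != l.2].
  by move=> /(allP lst); rewrite st => /and3P.
have [] := A_gen (X := [set x in [seq nth x0 t i | i <- X]]) (ps := map f ls).
- move=> _ /mapP[l /lsP[l1 l2 l12] ->].
  by rewrite inE /= !tA ?mem_nth //= nth_uniq.
- rewrite -map_comp; apply/(uniqPn ([set: T] : {set T})) => -[i [j [lij]]].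
  rewrite size_map => js; have is_ := ltn_trans lij js.
  rewrite !(nth_map (0, 0)) //= => eT.
  have [i1 i2 _] := lsP _ (mem_nth (0, 0) is_); have [j1 j2 _] := lsP _ (mem_nth (0, 0) js).
  have : nth [::] [seq mtrace s.1 l.1 l.2
    | l <- ls] i = nth [::] [seq mtrace s.1 l.1 l.2 | l <- ls] j.
    rewrite !(nth_map (0, 0)) // e1 !(mtrace_dmat x0) //; exact: trace_eq.
  move/eqP; rewrite nth_uniq ?size_map // => /eqP ij; by rewrite ij ltnn in lij.
- by rewrite size_map ls0.
- rewrite size_map cardsE; apply: leq_trans (card_size _) _; by rewrite size_map.
move=> _ /mapP[l lls ->] [[a b] rP eL].
have [l1 l2 l12] := lsP _ lls.
have [] := opts_complete rt _ l1 l2 l12 rP eL; first by rewrite -st.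
move=> s' s'o [t' rt'].
have : s' \in flatten [seq opts s X l.1 l.2 | l <- ls] by apply/flatten_mapP; exists l.
elim: cs (flatten _) IH => [|c cs IHcs] [|s1 ss] //= [IHc IH] s'in /andP[k1 k2].
move: s'in; rewrite inE => /predU1P[e|]; first by apply: (IHc t' s'); rewrite // e.
by move=> s'in; apply: (IHcs ss).
Qed.

End Soundness.

(** * Two pairs with a common point generating the same line *)

Definition types3 (a b c : nat) : seq (seq nat) :=
  let R := [:: 1; 2; 3] in
  flatten [seq flatten [seq [seq [:: x; y; z] | z <- R
    & [&& triangle x y a, triangle x z b & triangle y z c]] | y <- R] | x <- R].

(** The points 0, 1, 2 stand for x, y, w with d(x, y) = a, d(x, w) = b, d(y, w) = c, where xy and xw
    generate the same line. *)
Definition start (a b c : nat) : state :=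
  let M := [:: [:: 0; a; b]; [:: a; 0; c]; [:: b; c; 0]] in
  (M, vfilter M (types3 a b c) 0 1 0 2).

(* Found by computer search. *)
Definition cert112 := Excl 7 (Fork [:: 1] [:: (1, 3)] [::]) (Excl 0 (Excl 6 (Fork [:: 0]
  [:: (0, 4)] [:: Fork [:: 1] [:: (1, 5)] [::]]) (Excl 6 (Fork [:: 1] [:: (1, 4)] [::])
  (Excl 6 (Fork [:: 1] [:: (1, 4)] [::]) (Excl 6 (Fork [:: 1] [:: (1, 4)] [::]) (Excl 6
  (Fork [:: 0] [:: (0, 4)] [:: Fork [:: 1] [:: (1, 5)] [::]]) (Excl 6 (Fork [:: 1] [::
  (1, 4)] [::]) (Excl 6 (Fork [:: 1] [:: (1, 4)] [::]) (Excl 6 (Fork [:: 0] [:: (0, 4)]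
  [::]) (Excl 6 (Fork [:: 1] [:: (1, 4)] [::]) (Excl 1 (Excl 4 (Fork [:: 1] [:: (1, 5)]
  [::]) (Excl 4 (Fork [:: 1] [:: (1, 5)] [::]) (Excl 4 (Fork [:: 1] [:: (1, 5)] [::])
  (Excl 4 (Fork [:: 1] [:: (1, 5)] [::]) (Excl 4 (Fork [:: 1; 2] [:: (1, 0); (1, 3)]
  [::]) (Excl 4 (Fork [:: 0] [:: (0, 1)] [::]) (Excl 4 (Fork [:: 0] [:: (0, 3)] [::])
  (Excl 4 (Fork [:: 0] [:: (0, 3)] [::]) (Excl 0 (Fork [:: 0] [:: (0, 3)] [::]) (Excl 0
  (Fork [:: 0] [:: (0, 4)] [::]) (Excl 0 (Fork [:: 0] [:: (0, 3)] [::]) (Excl 0 (Fork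
  [:: 0] [:: (0, 3)] [::]) Stop)))))))))))) (Excl 1 (Fork [:: 1] [:: (1, 4)] [::]) (Excl
  1 (Fork [:: 1] [:: (1, 4)] [::]) (Excl 1 (Fork [:: 1; 2] [:: (1, 0); (1, 3)] [:: Fork
  [:: 0] [:: (0, 5)] [::]]) (Excl 1 (Fork [:: 0] [:: (0, 1)] [::]) (Excl 0 (Fork [:: 0]
  [:: (0, 4)] [::]) Stop))))))))))))))) (Excl 0 (Fork [:: 1] [:: (1, 3)] [:: Fork [:: 0]
  [:: (0, 4)] [:: Fork [:: 2] [:: (2, 1)] [::]]]) (Excl 0 (Fork [:: 0] [:: (0, 3)] [::
  Excl 0 (Fork [:: 0] [:: (0, 4)] [::]) (Excl 0 (Fork [:: 0] [:: (0, 4)] [::]) (Excl 0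
  (Fork [:: 0] [:: (0, 4)] [::]) (Excl 0 (Fork [:: 0] [:: (0, 4)] [::]) (Excl 0 (Fork
  [:: 0] [:: (0, 4)] [::]) (Excl 0 (Fork [:: 0] [:: (0, 4)] [::]) (Excl 0 (Fork [:: 0]
  [:: (0, 4)] [::]) Stop)))))); Excl 0 (Fork [:: 0; 1; 2] [:: (0, 3); (0, 4); (0, 1)]
  [::]) (Excl 0 (Fork [:: 0] [:: (0, 4)] [::]) (Excl 0 (Fork [:: 0] [:: (0, 4)] [::])
  (Excl 0 (Fork [:: 0] [:: (0, 4)] [::]) Stop))); Excl 0 (Fork [:: 0; 1; 2] [:: (0, 3);
  (0, 4); (0, 1)] [::]) (Excl 0 (Fork [:: 0] [:: (0, 4)] [::]) (Excl 0 (Fork [:: 0] [::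
  (0, 4)] [::]) (Excl 0 (Fork [:: 0] [:: (0, 4)] [::]) Stop)))]) (Excl 0 (Fork [:: 0]
  [:: (0, 3)] [:: Excl 0 (Fork [:: 0] [:: (0, 4)] [::]) (Excl 0 (Fork [:: 0] [:: (0, 4)]
  [::]) (Excl 0 (Fork [:: 0] [:: (0, 4)] [::]) (Excl 0 (Fork [:: 0] [:: (0, 4)] [::])
  (Excl 0 (Fork [:: 0] [:: (0, 4)] [::]) (Excl 0 (Fork [:: 0] [:: (0, 4)] [::]) (Excl 0
  (Fork [:: 0] [:: (0, 4)] [::]) Stop)))))); Excl 0 (Fork [:: 0; 1; 2] [:: (0, 3); (0,
  4); (0, 1)] [::]) (Excl 0 (Fork [:: 0] [:: (0, 4)] [::]) (Excl 0 (Fork [:: 0; 1; 2]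
  [:: (0, 3); (0, 4); (0, 1)] [::]) (Excl 0 (Fork [:: 0] [:: (0, 4)] [::]) (Excl 0 (Fork
  [:: 0] [:: (0, 4)] [::]) Stop)))); Excl 0 (Fork [:: 0; 1; 2] [:: (0, 3); (0, 4); (0,
  1)] [::]) (Excl 0 (Fork [:: 0; 2] [:: (0, 3); (0, 4)] [::]) (Excl 0 (Fork [:: 0] [::
  (0, 4)] [::]) (Excl 0 (Fork [:: 0] [:: (0, 4)] [::]) (Excl 0 (Fork [:: 0; 1; 2] [::
  (0, 3); (0, 4); (0, 1)] [::]) (Excl 0 (Fork [:: 0] [:: (0, 4)] [::]) (Excl 0 (Fork [::
  0] [:: (0, 4)] [::]) (Excl 0 (Fork [:: 0] [:: (0, 4)] [::]) (Excl 0 (Fork [:: 0] [::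
  (0, 4)] [::]) Stop))))))))]) (Excl 0 (Fork [:: 0] [:: (0, 3)] [::]) (Excl 0 (Fork [::
  0] [:: (0, 3)] [:: Excl 0 (Fork [:: 0] [:: (0, 4)] [::]) (Excl 0 (Fork [:: 0] [:: (0,
  4)] [::]) (Excl 0 (Fork [:: 0] [:: (0, 4)] [::]) (Excl 0 (Fork [:: 0] [:: (0, 4)]
  [::]) Stop))); Excl 0 (Fork [:: 0; 1; 2] [:: (0, 3); (0, 4); (0, 1)] [::]) (Excl 0
  (Fork [:: 0; 1] [:: (0, 3); (0, 4)] [::]) (Excl 0 (Fork [:: 0] [:: (0, 4)] [::]) (Excl
  0 (Fork [:: 0] [:: (0, 4)] [::]) (Excl 0 (Fork [:: 0] [:: (0, 4)] [::]) (Excl 0 (Fork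
  [:: 0] [:: (0, 4)] [::]) Stop))))); Excl 0 (Fork [:: 0; 1; 2] [:: (0, 3); (0, 4); (0,
  1)] [::]) (Excl 0 (Fork [:: 0] [:: (0, 4)] [::]) (Excl 0 (Fork [:: 0] [:: (0, 4)]
  [::]) Stop))]) (Excl 0 (Fork [:: 0] [:: (0, 1)] [::]) (Excl 0 (Fork [:: 0] [:: (0, 3)]
  [::]) Stop)))))))).

Definition cert121 := Excl 4 (Fork [:: 1] [:: (1, 3)] [::]) (Excl 7 (Fork [:: 1] [:: (1,
  3)] [::]) (Excl 1 (Excl 2 (Fork [:: 0; 1; 2] [:: (1, 3); (1, 4); (0, 1)] [::]) (Excl 2
  (Fork [:: 1] [:: (1, 3)] [::]) (Excl 2 (Fork [:: 1] [:: (1, 3)] [::]) (Excl 2 (Fork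
  [:: 1; 2] [:: (1, 3); (1, 4)] [::]) (Excl 3 (Fork [:: 0] [:: (0, 4)] [::]) (Excl 3
  (Fork [:: 1; 2] [:: (1, 3); (1, 4)] [::]) (Excl 3 (Fork [:: 1] [:: (1, 3)] [::]) (Excl
  3 (Fork [:: 1; 2] [:: (1, 0); (1, 4)] [::]) (Excl 3 (Fork [:: 0] [:: (0, 4)] [::])
  (Excl 0 (Fork [:: 0] [:: (0, 1)] [::]) (Excl 0 (Fork [:: 1; 2] [:: (1, 0); (1, 4)]
  [::]) (Excl 0 (Fork [:: 0] [:: (0, 4)] [::]) Stop)))))))))))) (Excl 1 (Excl 2 (Fork
  [:: 0; 1; 2] [:: (1, 3); (1, 4); (0, 1)] [::]) (Excl 2 (Fork [:: 1; 2] [:: (1, 3); (1,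
  4)] [::]) (Excl 3 (Fork [:: 1; 2] [:: (1, 3); (1, 4)] [::]) (Excl 3 (Fork [:: 1; 2]
  [:: (1, 3); (1, 4)] [::]) (Excl 3 (Fork [:: 0] [:: (0, 4)] [::]) (Excl 3 (Fork [:: 1;
  2] [:: (1, 3); (1, 4)] [::]) (Excl 3 (Fork [:: 1] [:: (1, 3)] [::]) (Excl 3 (Fork [::
  0; 1; 2] [:: (0, 3); (1, 4); (0, 1)] [::]) (Excl 3 (Fork [:: 1; 2] [:: (1, 0); (1, 4)]
  [::]) (Excl 3 (Fork [:: 0] [:: (0, 4)] [::]) (Excl 0 (Fork [:: 0] [:: (0, 1)] [::])
  (Excl 0 (Fork [:: 1; 2] [:: (1, 0); (1, 4)] [::]) (Excl 0 (Fork [:: 0] [:: (0, 4)]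
  [::]) Stop))))))))))))) (Excl 1 (Fork [:: 1; 2] [:: (1, 3); (1, 0)] [:: Fork [:: 0]
  [:: (0, 3)] [::]]) (Excl 1 (Fork [:: 0] [:: (0, 3)] [::]) (Excl 1 (Excl 1 (Fork [:: 0]
  [:: (0, 3)] [::]) (Excl 1 (Fork [:: 0; 1; 2] [:: (0, 3); (0, 4); (0, 1)] [::]) (Excl 1
  (Fork [:: 0; 1] [:: (0, 3); (0, 4)] [::]) (Excl 1 (Fork [:: 0] [:: (0, 1)] [::]) (Excl
  1 (Fork [:: 0] [:: (0, 4)] [::]) (Excl 1 (Fork [:: 0] [:: (0, 4)] [::]) (Excl 0 (Fork
  [:: 1; 2] [:: (1, 0); (1, 4)] [::]) Stop))))))) (Excl 1 (Fork [:: 0] [:: (0, 3)] [::])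
  (Excl 0 (Fork [:: 0] [:: (0, 3)] [::]) Stop)))))))).

Definition cert123 := Excl 4 (Fork [:: 1] [:: (1, 3)] [::]) (Excl 4 (Fork [:: 1] [:: (1,
  3)] [::]) (Excl 5 (Fork [:: 1] [:: (1, 3)] [::]) (Excl 5 (Fork [:: 1] [:: (1, 3)]
  [::]) (Excl 1 (Excl 2 (Fork [:: 0; 1; 2] [:: (1, 3); (1, 4); (0, 1)] [::]) (Excl 2
  (Fork [:: 1] [:: (1, 3)] [::]) (Excl 2 (Fork [:: 1] [:: (1, 3)] [::]) (Excl 2 (Fork
  [:: 1; 2] [:: (1, 3); (1, 4)] [::]) (Excl 3 (Fork [:: 1] [:: (1, 3)] [::]) (Excl 0
  (Fork [:: 0] [:: (0, 1)] [::]) (Excl 0 (Fork [:: 1; 2] [:: (1, 0); (1, 4)] [::]) (Excl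
  0 (Fork [:: 0] [:: (0, 4)] [::]) Stop)))))))) (Excl 1 (Fork [:: 0] [:: (0, 1)] [::
  Fork [:: 1] [:: (1, 4)] [::]]) (Excl 1 (Fork [:: 1; 2] [:: (1, 3); (1, 0)] [:: Fork
  [:: 0] [:: (0, 3)] [::]]) (Excl 1 (Excl 1 (Fork [:: 0] [:: (0, 3)] [::]) (Excl 1 (Fork
  [:: 0; 1; 2] [:: (0, 3); (0, 4); (0, 1)] [::]) (Excl 1 (Fork [:: 0; 1] [:: (0, 3); (0,
  4)] [::]) (Excl 0 (Fork [:: 1; 2] [:: (1, 0); (1, 4)] [::]) Stop)))) (Excl 0 (Fork [::
  0] [:: (0, 3)] [::]) Stop)))))))).

Definition cert132 := Excl 2 (Excl 1 (Fork [:: 1] [:: (1, 4)] [::]) (Excl 2 (Fork [:: 1]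
  [:: (1, 4)] [::]) (Excl 2 (Fork [:: 0; 1; 2] [:: (0, 3); (0, 4); (1, 2)] [::]) (Excl 2
  (Fork [:: 0] [:: (0, 3)] [::]) (Excl 3 (Fork [:: 1] [:: (1, 4)] [::]) (Excl 4 (Fork
  [:: 1] [:: (1, 4)] [::]) (Excl 5 (Fork [:: 0] [:: (0, 3)] [::]) (Excl 5 (Fork [:: 0]
  [:: (0, 1)] [::]) (Excl 6 (Fork [:: 1] [:: (1, 4)] [::]) (Excl 6 (Fork [:: 2] [:: (2,
  4)] [::]) (Excl 6 (Fork [:: 1] [:: (1, 4)] [::]) (Excl 0 (Fork [:: 0] [:: (0, 1)]
  [::]) (Excl 0 (Fork [:: 0] [:: (0, 4)] [::]) (Excl 0 (Fork [:: 0] [:: (0, 4)] [::])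
  (Excl 0 (Fork [:: 0] [:: (0, 4)] [::]) (Excl 0 (Fork [:: 0] [:: (0, 4)] [::]) (Excl 0
  (Fork [:: 0] [:: (0, 4)] [::]) Stop))))))))))))))))) (Excl 2 (Fork [:: 1] [:: (1, 3)]
  [::]) (Excl 2 (Fork [:: 1] [:: (1, 3)] [::]) (Excl 3 (Fork [:: 1] [:: (1, 3)] [:: Fork
  [:: 1; 2] [:: (1, 0); (1, 3)] [::]; Fork [:: 1; 2] [:: (1, 0); (1, 3)] [::]]) (Excl 3
  (Fork [:: 1] [:: (1, 3)] [::]) (Excl 3 (Fork [:: 1] [:: (1, 3)] [::]) (Excl 0 (Excl 1
  (Fork [:: 0] [:: (0, 3)] [::]) (Excl 2 (Fork [:: 1] [:: (1, 4)] [::]) (Excl 2 (Fork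
  [:: 0] [:: (0, 4)] [::]) (Excl 1 (Fork [:: 2] [:: (2, 4)] [::]) (Excl 1 (Fork [:: 1;
  2] [:: (1, 0); (1, 3)] [::]) (Excl 0 (Fork [:: 0] [:: (0, 4)] [::]) Stop)))))) (Excl 0
  (Fork [:: 1] [:: (1, 3)] [::]) (Excl 0 (Excl 0 (Fork [:: 0; 1; 2] [:: (0, 3); (0, 4);
  (0, 1)] [::]) (Excl 0 (Fork [:: 0; 1] [:: (0, 3); (0, 4)] [::]) Stop)) Stop)))))))).

Lemma cert112_ok : check cert112 (start 1 1 2) = true.
Proof. exact_no_check (erefl true). Qed.
Lemma cert121_ok : check cert121 (start 1 2 1) = true.
Proof. exact_no_check (erefl true). Qed.
Lemma cert123_ok : check cert123 (start 1 2 3) = true.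
Proof. exact_no_check (erefl true). Qed.
Lemma cert132_ok : check cert132 (start 1 3 2) = true.
Proof. exact_no_check (erefl true). Qed.

(** These are the collinear triples with {a, b} other than {2, 3}, up to the exchange of a and b. *)
Lemma certP a b c : (a, b, c) \in [:: (1, 1, 2); (1, 2, 1); (1, 2, 3); (1, 3, 2)] ->
  exists ce, check ce (start a b c).
Proof.
rewrite !inE => /or4P[] /eqP[-> -> ->].
- by exists cert112; apply: cert112_ok.
- by exists cert121; apply: cert121_ok.
- by exists cert123; apply: cert123_ok.
- by exists cert132; apply: cert132_ok.
Qed.

(** * Minimal counterexamples with at least 12 points *)

Section Step.
Variables (T : finType) (d : T -> T -> nat).
Hypothesis d_metric : metric3 d.
Variable A : {set T}.
Hypothesis A12 : 12 <= #|A|.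
Hypothesis fewA : #|lns d A| < #|A|.
Hypothesis IH : forall B : {set T}, #|B| < #|A| -> 9 <= #|B| -> #|B| <= #|lns d B|.

Let d0 x : d x x = 0. Proof. by case: d_metric. Qed.
Let dC x y : d x y = d y x. Proof. by case: d_metric. Qed.
Let d13 x y : x != y -> d x y \in [:: 1; 2; 3].
Proof. by case: d_metric => _ _ H _; apply: H. Qed.
Let dtri x y z : triangle (d x y) (d x z) (d y z). Proof. by case: d_metric. Qed.

(** Otherwise deleting X destroys all [size ps] lines. As at least 9 points remain, [IH] bounds the
    other lines from below, and A has at least |A| lines. *)
Lemma few_private (X : {set T}) (ps : seq (T * T)) :
  {subset ps <= pairs A} -> uniq [seq trl d A p | p <- ps] ->
  0 < size ps <= 3 -> #|X| <= size ps ->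
  exists2 p, p \in ps & exists2 r, r \in pairs (A :\: X) & trl d A r = trl d A p.
Proof.
move=> psA ups /andP[ps0 ps3] Xps.
case: (boolP [exists r in pairs (A :\: X), trl d A r \in [seq trl d A p | p <- ps]]).
  by case/exists_inP => r rP /mapP[p pps e]; exists p => //; exists r.
move/exists_inPn => no.
have : #|lns d (A :\: X)| + #|[set L in [seq trl d A p | p <- ps]]| <= #|lns d A|.
  apply: lns_setD => [|L p]; first by apply/subsetP=> L;
    rewrite inE => /mapP[p /psA pA ->]; apply: imset_f.
  by rewrite inE => Ls /no; apply: contraNneq => ->.
rewrite cardsE (card_uniqP ups) size_map.
have := cardsID X A; have := subset_leq_card (subsetIr A X) => c1 c2.
(* If X misses A, then [IH] does not apply, but nothing is deleted and no line can be lost. *)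
case: (posnP #|A :&: X|) => [c0|c0].
  have -> : A :\: X = A by apply/eqP; rewrite eqEcard subsetDl /=; lia.
  lia.
by have := IH (B := A :\: X); lia.
Qed.

Lemma realizes_start x y w : x \in A -> y \in A -> w \in A ->
  x != y -> x != w -> y != w -> trl d A (x, y) = trl d A (x, w) ->
  realizes d A [:: x; y; w] (start (d x y) (d x w) (d y w)).
Proof.
move=> xA yA wA xy xw yw e.
have M : (start (d x y) (d x w) (d y w)).1 = dmat d [:: x; y; w].
  by rewrite /dmat /= !d0 (dC y x) (dC w x) (dC w y).
split=> //; first by rewrite /= !inE negb_or xy xw yw.
  by move=> z; rewrite !inE => /or3P[] /eqP->.
move=> z zA; rewrite !inE !negb_or => /and3P[zx zy zw].
rewrite mem_filter -[X in vin X]/(start (d x y) (d x w) (d y w)).1 M.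
rewrite !(vin_dmat _ x) //= -[X in _ && X]/(_ \in _).
have /setP/(_ z) := e; rewrite !inE zA !andbT => -> /=; rewrite eqxx /= /types3.
apply/flatten_mapP; exists (d z x); first exact: d13.
apply/flatten_mapP; exists (d z y); first exact: d13.
apply: map_f; rewrite mem_filter d13 // andbT.
by apply/and3P; split; [have := dtri z x y|have := dtri z x w|have := dtri z y w].
Qed.

(** The point w lies on xw, hence on xy, so the three distances are collinear. In one of the two
    orders of y and w a certificate refutes them, unless the distances from x are 2 and 3. *)
Lemma equal_lines_at x y w : x \in A -> y \in A -> w \in A ->
  x != y -> x != w -> y != w -> trl d A (x, y) = trl d A (x, w) ->
  d x y + d x w = 5.
Proof.
move=> xA yA wA xy xw yw e.
have r1 := realizes_start xA yA wA xy xw yw e.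
have wy : w != y by rewrite eq_sym.
have r2 := realizes_start xA wA yA xw xy wy (esym e).
have K t s (c : Prop) : realizes d A t s -> (exists ce, check ce s) -> c.
  by move=> rs [ce k]; case: (check_sound d_metric A12 few_private rs k).
have : w \in ln d x y.
  by have /setP/(_ w) := e; rewrite !inE wA !andbT => ->; have := ln_r d_metric xw;
    rewrite inE.
rewrite in_ln (dC w x) (dC w y).
rewrite (dC w y) in r2.
have {}r1 := fun h => K _ _ (d x y + d x w = 5) r1 (certP h).
have {}r2 := fun h => K _ _ (d x y + d x w = 5) r2 (certP h).
move: (d13 xy) (d13 xw) (d13 yw) r1 r2; rewrite !inE.
by case/or3P=> /eqP-> /or3P[] /eqP-> /or3P[] /eqP-> // r1 r2 _;
  first [case: r1 => // | case: r2 => //].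
Qed.

(** Ordered pairs: each pair of points generating L is counted twice. *)
Definition gens (L : {set T}) := [set p in pairs A | trl d A p == L].

Lemma pairs_bound : #|A| * #|A| <= #|pairs A| + #|A|.
Proof.
rewrite -cardsX; have <- : #|[set (x, x) | x in A]| = #|A| by apply: card_imset => x y [].
apply: leq_trans (leq_card_setU _ _); apply: subset_leq_card.
apply/subsetP => -[x y]; rewrite !inE /= => /andP[xA yA]; rewrite xA yA /=.
by case: eqVneq => //= ->; apply: imset_f.
Qed.

(** Pigeonhole: n(n - 1) ordered pairs are distributed over at most n - 1 lines. *)
Lemma heavy_line : exists L, #|A| <= #|gens L|.
Proof.
have [/exists_inP[L _ h]|] := boolP [exists L in lns d A, #|A| <= #|gens L|];
  first by exists L.
move/exists_inPn => no.
have : #|pairs A| <= #|lns d A| * #|A|.-1.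
  rewrite -sum1_card (partition_big_imset (trl d A)) /= -sum_nat_const.
  apply: leq_sum => L /no; rewrite -ltnNge sum1dep_card -/(gens L) => h.
  by rewrite -ltnS prednK // (leq_trans _ h).
have := pairs_bound; nia.
Qed.

(** * A line generated by at least n ordered pairs *)

Section Heavy.
Variable L : {set T}.
Hypothesis heavyL : #|A| <= #|gens L|.

Lemma gensP x y : reflect [/\ x \in A, y \in A, x != y & trl d A (x, y) = L] ((x,
  y) \in gens L).
Proof.
by rewrite !inE /= -!andbA; apply: (iffP and4P) => -[-> -> -> /eqP->].
Qed.

Lemma gensC x y : (x, y) \in gens L -> (y, x) \in gens L.
Proof. by case/gensP => xA yA xy e; apply/gensP; rewrite eq_sym /trl /= lnC. Qed.

Lemma gens_in x y z : (x, y) \in gens L -> (z \in L) = (z \in A) &&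
  (collinear (d x z) (d y z) (d x y)).
Proof. by case/gensP => xA yA xy <-; rewrite inE andbC /= in_ln !(dC z). Qed.

Lemma gens_L x y : (x, y) \in gens L -> x \in L.
Proof. by move=> g; case/gensP: (g) => xA yA xy <-; rewrite !inE xA andbT -in_ln ln_l. Qed.

Lemma gens_inl x y u v : (x, y) \in gens L -> (u,
  v) \in gens L -> collinear (d x u) (d y u) (d x y).
Proof. by move=> g /gens_L; rewrite (gens_in _ g) => /andP[]. Qed.

Lemma gens_share x y w : (x, y) \in gens L -> (x,
  w) \in gens L -> y != w -> d x y + d x w = 5.
Proof.
case/gensP => xA yA xy e1 /gensP[_ wA xw e2] yw.
by apply: equal_lines_at => //; rewrite e1.
Qed.

(** Three distinct collinear points have exactly one distance 2 among them. So if d(x, y) = 2, then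
    x and y are at odd distances from u and v, which forces d(u, v) = 2; and conversely. *)
Lemma gens_type x y u v : (x, y) \in gens L -> (u, v) \in gens L ->
  [&& x != u, x != v, y != u & y != v] -> (d x y == 2) = (d u v == 2).
Proof.
move=> g h /and4P[xu xv yu yv].
have xy : x != y by case/gensP: g. have uv : u != v by case/gensP: h.
move: (gens_inl g h) (gens_inl g (gensC h)) (gens_inl h g) (gens_inl h (gensC g)).
rewrite !(dC u) !(dC v).
move: (d13 xy) (d13 uv) (d13 xu) (d13 xv) (d13 yu) (d13 yv); rewrite !inE.
by do 6![case/or3P=> /eqP->].
Qed.

(** The distances of three such pairs would add up to 5 two by two, but 15 is odd. *)
Lemma card_gens_at x : #|[set p in gens L | p.1 == x]| <= 2.
Proof.
rewrite leqNgt; apply/negP => /card_gt2P[[x1 a] [[x2 b] [[x3 c] [[]]]]].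
rewrite !(in_set (fun p => (p \in gens L) && _)) /=.
move=> /andP[ga /eqP e1] /andP[gb /eqP e2] /andP[gc /eqP e3];
  rewrite {}e1 {}e2 {}e3 in ga gb gc *.
rewrite !xpair_eqE !eqxx /= => -[ab bc ca].
have := gens_share ga gb ab; have := gens_share gb gc bc; have := gens_share gc ga ca; lia.
Qed.

(** Otherwise xy and xw have distances 2 and 3. By [gens_type] no generating pair is disjoint from
    both, so all of them meet {x, y, w}, and these are too few. *)
Lemma gens_uniq x y w : (x, y) \in gens L -> (x, w) \in gens L -> y = w.
Proof.
move=> g h; apply/eqP/negPn/negP => yw.
wlog [xy2 xw3] : y w g h yw / d x y = 2 /\ d x w = 3.
  move=> W; have s5 := gens_share g h yw.
  have [xy xw] : x != y /\ x != w by case/gensP: g; case/gensP: h.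
  have wy : w != y by rewrite eq_sym.
  move: (d13 xy) (d13 xw) s5; rewrite !inE.
  by case/or3P=> /eqP e1 /or3P[] /eqP e2; rewrite e1 e2 // => _;
    [apply: (W y w) | apply: (W w y)].
pose S1 a := [set p in gens L | p.1 == a].
pose S2 a := [set (p.2, p.1) | p in S1 a].
have cS1 a : #|S1 a| <= 2 := card_gens_at a.
have cS2 a : #|S2 a| <= 2 := leq_trans (leq_imset_card _ _) (cS1 a).
pose P1 := S1 x :|: S1 y :|: S1 w; pose P2 := S2 x :|: S2 y :|: S2 w.
have cP1 : #|P1| <= 6.
  have := (leq_card_setU (S1 x) (S1 y)).1; have := (leq_card_setU (S1 x :|: S1 y) (S1 w)).1.
  by move: (cS1 x) (cS1 y) (cS1 w); rewrite /P1; lia.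
have cP2 : #|P2| <= 6.
  have := (leq_card_setU (S2 x) (S2 y)).1; have := (leq_card_setU (S2 x :|: S2 y) (S2 w)).1.
  by move: (cS2 x) (cS2 y) (cS2 w); rewrite /P2; lia.
have inS1 a b : (a, b) \in gens L -> (a, b) \in S1 a by move=> k;
  rewrite /S1 in_set k /= eqxx.
have inS2 a b : (a, b) \in gens L -> (a, b) \in S2 b.
  by move=> /gensC/inS1 k; apply/imsetP; exists (b, a).
have sub : gens L \subset P1 :|: P2.
  apply/subsetP => -[a b] k; apply/negPn/negP => out.
  have {out} [ax ay aw [bx by_ bw]] : [/\ x != a, y != a, w != a & [/\ x != b,
    y != b & w != b]].
    move: out; rewrite !in_setU !negb_or -!andbA => /and5P[a1 a2 a3 b1 /andP[b2 b3]].
    have [k1 k2] := (inS1 _ _ k, inS2 _ _ k).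
    by do 2?split; [apply: contraNneq a1 | apply: contraNneq a2 | apply: contraNneq a3
      | apply: contraNneq b1 | apply: contraNneq b2 | apply: contraNneq b3] => ->.
  have e2 := gens_type g k; rewrite ax ay bx by_ xy2 in e2.
  by have := gens_type h k; rewrite ax aw bx bw xw3 -e2 // => /(_ isT).
(* At most 6 pairs start and at most 6 end in the triple; (x, y) does both, so there are at most 11,
   against at least 12. *)
have g12 : (x, y) \in P1 :&: P2 by rewrite !(in_setI, in_setU) inS1 // (inS2 _ _ g) orbT.
have c1 : 0 < #|P1 :&: P2| by apply/card_gt0P; exists (x, y).
have := leq_trans heavyL (subset_leq_card sub).
have := cardsUI P1 P2; move: #|_ :|: _| #|_ :&: _| c1 #|P1| #|P2| cP1 cP2 A12.
by move=> u v; move: #|A|; lia.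
Qed.

(** The first projection is injective on [gens L] and maps it into A, and [gens L] is at least as
    large as A. *)
Lemma exists_partner x : x \in A -> exists y, (x, y) \in gens L.
Proof.
have inj : {in gens L &, injective (fun p : T * T => p.1)}.
  by move=> [a b] [a' b'] /= g h e; rewrite -{}e in h *; rewrite (gens_uniq g h).
have sub : [set p.1 | p in gens L] \subset A.
  by apply/subsetP => _ /imsetP[[a b] /gensP[aA _ _ _] ->].
have /eqP <- : [set p.1 | p in gens L] == A by rewrite eqEcard sub card_in_imset.
by case/imsetP => -[a b] g ->; exists b.
Qed.

(** * The perfect matching and the lines joining two of its pairs *)

Definition partner x := odflt x [pick y | (x, y) \in gens L].
Local Notation s := partner.

Lemma partnerP x : x \in A -> (x, s x) \in gens L.
Proof.
rewrite /partner => /exists_partner[y g]; case: pickP => [//|/(_ y)].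
by rewrite g.
Qed.

Lemma partner_in x : x \in A -> s x \in A.
Proof. by move/partnerP/gensP => []. Qed.

Lemma partner_neq x : x \in A -> x != s x.
Proof. by move/partnerP/gensP => []. Qed.

Lemma partnerK x : x \in A -> s (s x) = x.
Proof.
move=> xA; have g := partnerP xA; apply: (@gens_uniq (s x)); last exact: gensC.
exact/partnerP/partner_in.
Qed.

Definition quad x y := [set x; s x; y; s y].
(* The pairs of the perfect matching contained in M. *)
Definition full (M : {set T}) := [set u in A | (u \in M) && (s u \in M)].

(** Here a and b are the distances within two matched pairs xx' and yy', and p, q, r, t those of xy,
    xy', x'y, x'y'. One of the latter pairs is at distance e and has all four points on its line. *)
Lemma four_distances a b p q r t : all (mem [:: 1; 2; 3]) [:: a; b; p; q; r; t] ->
  collinear p q b -> collinear r t b -> collinear p r a -> collinear q t a ->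
  let e := if a == 2 then 1 else 2 in
  [|| [&& p == e, collinear a r p & collinear q b p], [&& q == e,
    collinear a t q & collinear p b q],
      [&& r == e, collinear a p r & collinear t b r] | [&& t == e,
        collinear a q t & collinear r b t]].
Proof.
rewrite /= !inE !andbT => /and5P[+ + + + /andP[]].
by do 6![case/or3P=> /eqP->].
Qed.

(** This explains the choice of e, again because a collinear triple has exactly one 2. If c = 2,
    then zu and wu are odd and e = 1 leaves no 2; otherwise zu or zu' is 2 and e = 2 is a second
    one. *)
Lemma three_pairs zu zu' wu wu' c e : all (mem [:: 1; 2; 3]) [:: zu; zu'; wu; wu'; c] ->
  e = (if c == 2 then 1 else 2) -> collinear zu zu' c -> collinear wu wu' c ->
  collinear zu wu e -> collinear zu' wu' e -> False.
Proof.
rewrite /= !inE !andbT => /and5P[] h1 h2 h3 h4 h5 ->; move: h1 h2 h3 h4 h5.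
by do 5![case/or3P=> /eqP->].
Qed.

(** A third matched pair u, [s u] inside the line has by [gens_type] the same value of e, and
    [three_pairs] excludes it. *)
Lemma full_crossing z w : z \in A -> w \in A -> z != w -> s z != w ->
  d z w = (if d z (s z) == 2 then 1 else 2) -> s z \in ln d z w -> s w \in ln d z w ->
  full (trl d A (z, w)) = quad z w.
Proof.
move=> zA wA zw szw dzw szl swl.
have [gz gw] := (partnerP zA, partnerP wA).
have [szA swA] := (partner_in zA, partner_in wA).
apply/setP => u; rewrite in_set /trl !in_setI /=; apply/idP/idP.
  case/andP=> uA /andP[/andP[ul _] /andP[sul _]]; rewrite !inE -!orbA.
  apply/negPn/negP; rewrite !negb_or => /and4P[uz usz uw usw].
  have gu := partnerP uA; have su := partnerK uA.
  have [suz sususz] : s u != z /\ s u != s z.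
    split; first by apply: contraNneq usz => <-; rewrite su.
    by apply: contraNneq uz => e; rewrite -su e partnerK.
  have [suw sususw] : s u != w /\ s u != s w.
    split; first by apply: contraNneq usw => <-; rewrite su.
    by apply: contraNneq uw => e; rewrite -su e partnerK.
  have t1 : (d z (s z) == 2) = (d u (s u) == 2).
    by apply: gens_type => //; rewrite ![z == _]eq_sym ![s z == _]eq_sym uz suz usz.
  apply: (@three_pairs (d u z) (d (s u) z) (d u w) (d (s u) w) (d u (s u)) (d z w)).
  - by rewrite /= !d13 // partner_neq.
  - by rewrite dzw t1.
  - exact: gens_inl gu gz.
  - exact: gens_inl gu gw.
  - by rewrite -in_ln.
  - by rewrite -in_ln.
have zl : z \in ln d z w := ln_l d_metric zw.
have wl : w \in ln d z w := ln_r d_metric zw.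
rewrite !inE -!orbA => /or4P[] /eqP->;
  rewrite ?(partnerK zA) ?(partnerK wA) ?zA ?wA ?szA ?swA ?andbT;
  by rewrite -!(in_ln d) ?zl ?wl ?szl ?swl.
Qed.

Lemma crossing_line x y : x \in A -> y \in A -> x != y -> s x != y ->
  exists2 M, M \in lns d A & full M = quad x y.
Proof.
move=> xA yA xy sxy.
have [gx gy] := (partnerP xA, partnerP yA).
have sx := partnerK xA; have sy := partnerK yA.
have [sxA syA] := (partner_in xA, partner_in yA).
have [nx ny] := (partner_neq xA, partner_neq yA).
have xsy : x != s y by apply: contraNneq sxy => e; rewrite e sy.
have sxsy : s x != s y by apply: contraNneq xy => e; rewrite -sx e sy.
have line_in z w : z \in A -> w \in A -> z != w -> trl d A (z, w) \in lns d A.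
  by move=> zA wA zw; apply: imset_f; rewrite inE /= zA wA zw.
(* Replacing x by [s x] or y by [s y] does not change [quad x y]; this covers the four cases of
   [four_distances]. *)
have lns_of z w : z \in A -> w \in A -> z != w -> s z != w -> quad z w = quad x y ->
    d z w = (if d z (s z) == 2 then 1 else 2) -> s z \in ln d z w -> s w \in ln d z w ->
    exists2 M, M \in lns d A & full M = quad x y.
  move=> zA wA zw szw e dzw szl swl; exists (trl d A (z, w)); first exact: line_in.
  by rewrite full_crossing.
have := @four_distances (d x (s x)) (d y (s y)) (d x y) (d x (s y)) (d (s x) y) (d (s x)
  (s y)).
rewrite /= !d13 // => /(_ isT).
have q1 := gens_inl gy gx; have q2 := gens_inl gy (gensC gx).
have q3 := gens_inl gx gy; have q4 := gens_inl gx (gensC gy).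
rewrite !(dC y) !(dC (s y)) in q1 q2.
move=> /(_ q1 q2 q3 q4) /or4P[] /and3P[/eqP e c1 c2].
- apply: (lns_of x y) => //; rewrite in_ln.
    by rewrite (dC (s x) x).
  by rewrite (dC (s y) x) (dC (s y)).
- apply: (lns_of x (s y)); rewrite ?sy //;
  first by rewrite /quad sy -!setUA (setUC [set y]).
    by rewrite in_ln (dC (s x) x).
  by rewrite in_ln (dC y x).
- apply: (lns_of (s x) y); rewrite ?sx //; first by rewrite /quad sx (setUC [set x]).
  + by rewrite (dC (s x) x).
  + by rewrite in_ln.
  by rewrite in_ln (dC (s y) (s x)) (dC (s y)).
apply: (lns_of (s x) (s y)); rewrite ?sx ?sy //.
- by rewrite /quad sx sy (setUC [set s x]) -!setUA (setUC [set y]).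
- by rewrite (dC (s x) x).
- by rewrite in_ln.
by rewrite in_ln (dC y (s x)).
Qed.

(** By [crossing_line] distinct quads come from distinct lines. There are at least n(n - 2)/8 quads,
    which exceeds n - 1 for n >= 12. *)
Lemma no_heavy_line : False.
Proof.
pose Pr := [set p in setX A A | (p.1 != p.2) && (s p.1 != p.2)].
have cPr : #|A| * #|A| <= #|Pr| + #|A| + #|A|.
  rewrite -cardsX.
  have c1 : #|[set (x, x) | x in A]| <= #|A| := leq_imset_card _ _.
  have c2 : #|[set (x, s x) | x in A]| <= #|A| := leq_imset_card _ _.
  have sub : setX A A \subset Pr :|: [set (x, x) | x in A] :|: [set (x, s x) | x in A].
    apply/subsetP => -[x y]; rewrite in_setX => /andP[xA yA];
      rewrite !in_setU in_set in_setX xA yA /=.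
    case: eqVneq => [->|_] /=; first by rewrite imset_f.
    by case: eqVneq => [<-|_] //=; rewrite (imset_f (fun x => (x, s x))) ?orbT.
  have := subset_leq_card sub; have := (leq_card_setU Pr [set (x, x) | x in A]).1.
  have := (leq_card_setU (Pr :|: [set (x, x) | x in A]) [set (x, s x) | x in A]).1; lia.
(* A quad arises from two orders of its matched pairs and two choices of a point in each. *)
have c8 Q : #|[set p in Pr | quad p.1 p.2 == Q]| <= 8.
  have [->|/set0Pn[[a b]]] := eqVneq [set p in Pr | quad p.1 p.2 == Q] set0;
    first by rewrite cards0.
  rewrite in_set in_set in_setX /= -!andbA => /and5P[aA bA ab sab /eqP <-].
  have [sa sb] := (partnerK aA, partnerK bA).
  set l := [:: (a, b); (a, s b); (s a, b); (s a, s b); (b, a); (b, s a); (s b, a);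
    (s b, s a)].
  apply: (leq_trans _ (card_size l)); apply: subset_leq_card; apply/subsetP => -[u v].
  rewrite in_set in_set in_setX /= -!andbA => /and5P[uA vA uv suv /eqP e].
  have : u \in quad a b by rewrite -e !inE eqxx.
  have : v \in quad a b by rewrite -e !inE eqxx orbT.
  rewrite !inE -!orbA !xpair_eqE.
  by case/or4P => /eqP ev /or4P[] /eqP eu; move: uv suv; rewrite eu ev ?sa ?sb !eqxx ?orbT.
have : #|Pr| <= #|lns d A| * 8.
  rewrite -sum1_card (partition_big_imset (fun p => quad p.1 p.2)) /=.
  set I := _ @: _.
  have cI : #|I| <= #|lns d A|.
    apply: (leq_trans _ (leq_imset_card full (lns d A))); apply: subset_leq_card.
    apply/subsetP => _ /imsetP[[x y] + ->]; rewrite in_set in_setX /= -!andbA.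
    case/and4P=> xA yA xy sxy; have [M Ml <-] := crossing_line xA yA xy sxy; exact: imset_f.
  apply: (leq_trans _ (leq_mul cI (leqnn 8))); rewrite -sum_nat_const.
  by apply: leq_sum => Q _; rewrite sum1dep_card.
have := fewA; have := A12; nia.
Qed.

End Heavy.

Lemma no_counterexample : False.
Proof. by have [L /no_heavy_line] := heavy_line. Qed.

End Step.

(** * Enumeration of spaces with few lines *)

Lemma positive_eqP : Equality.axiom Pos.eqb.
Proof.
by move=> x y; apply: (iffP idP); [move/Pos.eqb_eq | move=> ->; apply/Pos.eqb_eq].
Qed.
HB.instance Definition _ := hasDecEq.Build positive positive_eqP.

(* Spaces are built by adding points in front: the code of x :: t is the row of
   the distances from x to t followed by the code of t.  [masks] lists the lines
   generated by all pairs of points as bit vectors. *)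
Definition bit (b : bool) (m : positive) : positive := if b then xI m else xO m.
Fixpoint mask (f : seq bool) : positive := if f is b :: f then bit b (mask f) else xH.

(** The vector f serves twice for a new point x and an old point y: it gives the later points z on
    xy and, as z is on xy iff y is on xz, the bits of y for the lines xz. In [new_bits] it tells
    whether x is on yz. *)
Fixpoint new_masks (v : seq nat) (code : seq (seq nat)) : seq positive :=
  match v, code with
  | x :: v, r :: code =>
      let f := map2 (collinear x) v r in xI (mask f) :: map2 bit f (new_masks v code)
  | _, _ => [::]
  end.
Fixpoint new_bits (v : seq nat) (code : seq (seq nat)) : seq bool :=
  match v, code with
  | x :: v, r :: code => map2 (collinear x) v r ++ new_bits v code
  | _, _ => [::]
  end.
Fixpoint masks (code : seq (seq nat)) : seq positive :=
  if code is r :: code then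
    map xI (new_masks r code) ++ map2 bit (new_bits r code) (masks code)
  else [::].

Fixpoint within (k : nat) (ms : seq positive) (t : PositiveSet.t) : bool :=
  match ms with
  | [::] => true
  | m :: ms => if PositiveSet.mem m t then within k ms t else
      if k is k'.+1 then within k' ms (PositiveSet.add m t) else false
  end.
Definition at_most K code := within K (masks code) PositiveSet.empty.

(* Each result consists of the distances v from a new point to the given ones,
   the masks of the lines through the new point (without its own bit), and for
   each old pair the bit telling whether the new point is on its line. *)
Fixpoint extensions (K : nat) (code : seq (seq nat)) :
    seq (seq nat * seq positive * seq bool) :=
  if code is r :: code' then
    let sm := masks code in
    flatten [seq (let: (v, nl, nb) := st in
      flatten [seq (if all2b (triangle x) v r then
          let f := map2 (collinear x) v r in
          let nl' := xI (mask f) :: map2 bit f nl in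
          let nb' := f ++ nb in
          if within K (map xI nl' ++ map2 bit nb' sm) PositiveSet.empty
          then [:: (x :: v, nl', nb')] else [::]
        else [::]) | x <- [:: 1; 2; 3]]) | st <- extensions K code']
  else [:: ([::], [::], [::])].

Fixpoint full_matrix (code : seq (seq nat)) : seq (seq nat) :=
  if code is r :: code then (0 :: r) :: map2 cons r (full_matrix code) else [::].
Fixpoint recode (M : seq (seq nat)) (o : seq nat) : seq (seq nat) :=
  if o is i :: o then [seq mget M i j | j <- o] :: recode M o else [::].

(* The ordering of the points is only a heuristic keeping the enumeration almost
   free of isomorphic copies: [canon] checks that it is a permutation.  Two rounds
   of colour refinement with arbitrary weights are followed by a greedy choice. *)
Definition weights : seq N := [:: 82644; 34481; 98227; 47993; 91498; 97979; 86463; 70473;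
  4801; 62030; 33643; 86062; 7796; 21558; 15838; 49731; 62481; 33318; 50906; 72271;
  14365; 76227; 33680; 2718; 96837; 29407; 54497; 37632; 24865; 52044; 21919; 10428;
  19188; 81992; 81930; 59305; 17606; 18333; 1232; 1696]%num.

Definition signature M (col : seq nat) : seq N :=
  [seq foldl N.add 0%num (map2 (fun c a =>
    nth 0%num weights (4 * c + a)) col row) | row <- M].
Definition ranks (s : seq N) : seq nat := [seq count (fun y => N.ltb y x) s | x <- s].

Fixpoint max_key (s : seq (N * nat)) (b : N * nat) : N * nat :=
  if s is x :: s then max_key s (if N.ltb b.1 x.1 then x else b) else b.
Fixpoint greedy (k : nat) M (s : seq (N * nat)) : seq nat :=
  if s is x :: s' then
    if k is k'.+1 then
      let b := (max_key s' x).2 in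
      let row := nth [::] M b in
      b :: greedy k' M [seq (N.add (N.double (N.double y.1)) (N.of_nat (nth 0 row y.2)),
        y.2)
                       | y <- s & ~~ eqn y.2 b]
    else [::]
  else [::].
Definition canon_order M : seq nat :=
  let m := size M in
  let c1 := ranks (signature M (nseq m 0)) in
  greedy m M (zip (signature M c1) (iota 0 m)).
Definition canon code :=
  let M := full_matrix code in
  let o := canon_order M in
  if perm_eq o (iota 0 (size M)) then recode M o else code.

Fixpoint lex (s t : seq nat) : bool :=
  match s, t with
  | x :: s, y :: t => (x < y) || eqn x y && lex s t
  | [::], _ => true
  | _, _ => false
  end.
Definition lex_code (s t : seq (seq nat)) := lex (flatten s) (flatten t).
Fixpoint dedup (s : seq (seq (seq nat))) :=
  if s is x :: s' then
    let t := dedup s' in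
    if t is y :: _ then (if x == y then t else x :: t) else [:: x]
  else [::].
Definition grow K R := dedup (sort lex_code
  (flatten [seq [seq canon (st.1.1 :: code) | st <- extensions K code] | code <- R])).

Definition seeds : seq (seq (seq nat)) := [:: [:: [:: 1]; [::]]; [:: [:: 2]; [::]];
  [:: [:: 3]; [::]]].

Lemma mem_add_positive m m' t :
  PositiveSet.mem m' (PositiveSet.add m t) = (m' == m) || PositiveSet.mem m' t.
Proof.
apply/idP/idP.
  move/PositiveSet.mem_spec/PositiveSet.add_spec => [->|/PositiveSet.mem_spec->];
    first by rewrite eqxx.
  by rewrite orbT.
move=> h; apply/PositiveSet.mem_spec/PositiveSet.add_spec.
by case/predU1P: h => [->|/PositiveSet.mem_spec]; [left|right].
Qed.

Lemma size_undup_cons (U : eqType) (x : U) s :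
  size (undup (x :: s)) = (size (undup [seq y <- s | y != x])).+1.
Proof.
rewrite -/(size (x :: undup [seq y <- s | y != x])); apply/perm_size/uniq_perm.
- exact: undup_uniq.
- by rewrite /= mem_undup mem_filter eqxx undup_uniq.
by move=> y; rewrite mem_undup !inE mem_undup mem_filter; case: eqVneq.
Qed.

Lemma withinE k ms t :
  within k ms t = (size (undup [seq m <- ms | ~~ PositiveSet.mem m t]) <= k).
Proof.
elim: ms k t => //= m ms IH k t; case: ifP => mt /=; first exact: IH.
rewrite -/(undup (m :: [seq m' <- ms | ~~ PositiveSet.mem m' t])) size_undup_cons.
case: k => [//|k]; rewrite IH ltnS -filter_predI; congr (size (undup _) <= _).
by apply: eq_filter => m'; rewrite mem_add_positive negb_or.
Qed.

Lemma mask_inj f g : size f = size g -> mask f = mask g -> f = g.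
Proof.
by elim: f g => [|a f IH] [|b g] //= [e]; case: a; case: b => //= -[] /(IH _ e) ->.
Qed.

Lemma size_undup_map (U V : eqType) (f : U -> V) s :
  {in s &, injective f} -> size (undup (map f s)) = size (undup s).
Proof.
move=> inj; rewrite -(size_map f (undup s)); apply/perm_size/uniq_perm.
- exact: undup_uniq.
- by rewrite map_inj_in_uniq ?undup_uniq // => x y; rewrite !mem_undup; apply: inj.
move=> y; rewrite mem_undup; apply/mapP/mapP => -[x xs ->]; exists x => //.
  by rewrite mem_undup.
by rewrite mem_undup in xs.
Qed.

Lemma mem_dedup (s : seq (seq (seq nat))) : dedup s =i s.
Proof.
elim: s => // x s IH y; rewrite inE -IH /=.
case: (dedup s) => [//|z t]; case: eqVneq => [->|_] //.
by rewrite inE; case: eqP.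
Qed.

Lemma mem_grow K Rs c st : c \in Rs -> st \in extensions K c ->
  canon (st.1.1 :: c) \in grow K Rs.
Proof.
move=> cR sE; rewrite mem_dedup mem_sort; apply/flatten_mapP; exists c => //.
by apply/mapP; exists st.
Qed.

(** * Correctness of the enumeration *)

Section Enumeration.
Variables (T : finType) (d : T -> T -> nat).
Hypothesis d_metric : metric3 d.

Let d0 x : d x x = 0. Proof. by case: d_metric. Qed.
Let dC x y : d x y = d y x. Proof. by case: d_metric. Qed.
Let d13 x y : x != y -> d x y \in [:: 1; 2; 3].
Proof. by case: d_metric => _ _ H _; apply: H. Qed.
Let dtri x y z : triangle (d x y) (d x z) (d y z). Proof. by case: d_metric. Qed.

Fixpoint code (t : seq T) : seq (seq nat) :=
  if t is x :: t then map (d x) t :: code t else [::].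

Fixpoint seq_pairs (t : seq T) : seq (T * T) :=
  if t is x :: t then [seq (x, y) | y <- t] ++ seq_pairs t else [::].

Definition line_mask (t : seq T) (p : T * T) : positive :=
  mask [seq z \in ln d p.1 p.2 | z <- t].

Lemma ln_triple x y z : collinear (d x y) (d x z) (d y z) = (z \in ln d x y).
Proof. by rewrite in_ln (dC z x) (dC z y) collinearC collinearCA collinearC collinearCA
  collinearC. Qed.

Lemma line_mask_cons x t p : line_mask (x :: t) p = bit (x \in ln d p.1 p.2) (line_mask t
  p).
Proof. by []. Qed.

Lemma new_masksE x t : uniq (x :: t) ->
  new_masks (map (d x) t) (code t) = [seq line_mask t (x, y) | y <- t].
Proof.
elim: t => //= y t IH; rewrite inE negb_or => /andP[/andP[xy xt] /andP[yt ut]].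
have f : map2 (collinear (d x y)) (map (d x) t) (map (d y) t) = [seq z \in ln d x y
  | z <- t].
  by rewrite map2_map; apply: eq_map => z /=; rewrite ln_triple.
rewrite f IH /= ?xt // map2_map; congr (_ :: _).
  by rewrite line_mask_cons ln_r.
by apply: eq_map => z; rewrite line_mask_cons /= (ln_rot d_metric x z).
Qed.

Lemma new_bitsE x t :
  new_bits (map (d x) t) (code t) = [seq x \in ln d p.1 p.2 | p <- seq_pairs t].
Proof.
elim: t => //= y t IH; rewrite IH map_cat -map_comp map2_map; congr (_ ++ _).
by apply: eq_map => z /=; rewrite ln_triple (ln_rot d_metric y z) lnC.
Qed.

Lemma masksE t : uniq t -> masks (code t) = [seq line_mask t p | p <- seq_pairs t].
Proof.
elim: t => // x t IH ut; have /andP[xt ut'] := ut.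
rewrite [masks _]/= new_masksE // new_bitsE IH // map2_map map_cat -!map_comp.
congr (_ ++ _); apply/eq_in_map => y yt; rewrite /= line_mask_cons ln_l //=.
by apply: contraNneq xt => ->.
Qed.

Lemma mem_seq_pairs t x y : uniq t -> x \in t -> y \in t -> x != y ->
  (x, y) \in seq_pairs t \/ (y, x) \in seq_pairs t.
Proof.
elim: t => //= z t IH /andP[zt ut]; rewrite !inE !mem_cat.
case/predU1P => [->|xt] /predU1P[->|yt] xy; first by rewrite eqxx in xy.
- by left; rewrite map_f.
- by right; rewrite map_f.
by case: (IH ut xt yt xy) => ->; rewrite orbT; [left|right].
Qed.

Lemma seq_pairs_sub t p : uniq t -> p \in seq_pairs t -> [/\ p.1 \in t,
  p.2 \in t & p.1 != p.2].
Proof.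
elim: t => //= z t IH /andP[zt ut];
  rewrite mem_cat => /orP[/mapP[y yt ->]|/(IH ut)[p1 p2 p12]].
  by rewrite !inE eqxx yt orbT; split=> //; apply: contraNneq zt => /= ->.
by rewrite !inE p1 p2 !orbT.
Qed.

Lemma lines_seqE t : uniq t ->
  lns d [set x in t] = [set L in [seq trl d [set x in t] p | p <- seq_pairs t]].
Proof.
move=> ut; apply/setP => L; rewrite inE; apply/imsetP/mapP => -[p].
  rewrite !inE => /and3P[p1 p2 p12] ->.
  have [h|h] := mem_seq_pairs ut p1 p2 p12; first by exists p;
    rewrite // {1}[p]surjective_pairing.
  by exists (p.2, p.1) => //; rewrite /trl /= lnC.
by move=> /(seq_pairs_sub ut)[p1 p2 p12] ->; exists p; rewrite // !inE p1 p2.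
Qed.

Lemma at_mostE K t : uniq t -> at_most K (code t) = (#|lns d [set x in t]| <= K).
Proof.
move=> ut; rewrite /at_most withinE (eq_filter (a2 := predT)) ?filter_predT; last first.
  by move=> m; case: m.
rewrite masksE // lines_seqE // cardsE; congr (_ <= _).
set s := [seq trl _ _ _ | _ <- _].
rewrite (_ : #|_| = size (undup s)); last first.
  rewrite -(card_uniqP (undup_uniq s)); apply: eq_card => L; by rewrite mem_undup.
have -> : [seq line_mask t p | p <- seq_pairs t] = [seq mask [seq z \in (L : {set T})
  | z <- t] | L <- s].
  rewrite /s -map_comp; apply: eq_map => p; congr mask; apply/eq_in_map => z zt.
  by rewrite /trl !inE zt andbT.
apply: size_undup_map => L M /mapP[p _ ->] /mapP[q _ ->] /mask_inj e.
have {}e := e _; rewrite !size_map in e; move/eq_in_map: (e erefl) => {}e.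
apply/setP => z; case zt: (z \in t); first exact: e.
by rewrite !inE zt !andbF.
Qed.

(** The pruning never discards x: the intermediate spaces consist of x and a final segment of t, and
    a subspace has no more lines than the whole. *)
Lemma mem_extensions K x t : uniq (x :: t) -> #|lns d [set y in x :: t]| <= K ->
  (map (d x) t, new_masks (map (d x) t) (code t), new_bits (map (d x) t) (code t))
    \in extensions K (code t).
Proof.
elim: t => [|y t IH] ut few; first by rewrite /= inE.
have ut' : uniq (x :: t) by move: ut; rewrite /= !inE !negb_or -!andbA => /and4P[_ -> _ ->].
have := IH ut' (leq_trans (lns_sub _ _) few) => {}IH.
apply/flatten_mapP; exists (map (d x) t, new_masks (map (d x) t) (code t),
  new_bits (map (d x) t) (code t)).
  by apply: IH; apply/subsetP => z; rewrite !inE => /orP[->|->] //; rewrite !orbT.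
have xy : x != y by move: ut; rewrite /= inE negb_or -andbA => /andP[].
apply/flatten_mapP; exists (d x y); first exact: d13.
rewrite all2b_map (_ : all _ _ = true); last by apply/allP => z _; apply: dtri.
rewrite -at_mostE // in few; cbv zeta; case: ifP => [_|/negP[]];
  [by rewrite inE | exact: few].
Qed.

Lemma full_matrixE t : full_matrix (code t) = dmat d t.
Proof.
elim: t => //= x t ->; rewrite /dmat /= d0 map2_map; congr (_ :: _).
by apply: eq_map => y; rewrite dC.
Qed.

Lemma canonP t : uniq t -> exists2 t', perm_eq t' t & code t' = canon (code t).
Proof.
move=> ut; rewrite /canon full_matrixE size_dmat; case: ifP => [po|_]; last by exists t.
case: t ut po => [|x0 t'] ut po.
  by exists [::]; rewrite // (perm_small_eq _ po).
set t := x0 :: t' in ut po *; set o := canon_order _ in po *.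
exists [seq nth x0 t i | i <- o].
  by rewrite -[X in perm_eq _ X](mkseq_nth x0); apply: perm_map.
have : all (ltn^~ (size t)) o by apply/allP => i; rewrite (perm_mem po) mem_iota.
elim: o {po} => //= i o IH /andP[it ot]; rewrite IH //; congr (_ :: _).
rewrite -map_comp; apply/eq_in_map => j jo /=.
by rewrite (mget_dmat _ x0) //; apply: (allP ot).
Qed.

(** Induction on k: the points after the first span at most K lines as well, hence are enumerated up
    to order, and the first point is one of their extensions. *)
Lemma enumerated K k t : uniq t -> size t = k.+2 -> #|lns d [set x in t]| <= K ->
  exists2 t', perm_eq t' t & code t' \in iter k (grow K) seeds.
Proof.
elim: k t => [|k IH] t ut st few.
  case: t ut st few => [|x [|y []]] //= ut _ _; exists [:: x; y] => //=.
  have xy : x != y by move: ut; rewrite inE andbT.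
  by move: (d13 xy); rewrite !inE => /or3P[] /eqP->.
case: t ut st few => // x t ut [st] few; have /andP[xt ut'] := ut.
have [] := IH t ut' st.
  by apply: leq_trans (lns_sub _ _) few; apply/subsetP => z; rewrite !inE => ->;
    rewrite orbT.
move=> t1 pt1 c1; have pt : perm_eq (x :: t1) (x :: t) by rewrite perm_cons.
have ut1 : uniq (x :: t1) by rewrite (perm_uniq pt).
have few1 : #|lns d [set z in x :: t1]| <= K.
  by rewrite (_ : [set z in x :: t1] = [set z in x :: t]) //; apply/setP => z;
    rewrite !inE (perm_mem pt1).
have [t' pt' ct'] := canonP ut1.
exists t'; first exact: perm_trans pt.
by rewrite iterS ct'; apply: (mem_grow c1 (mem_extensions ut1 few1)).
Qed.

End Enumeration.

(** * The exceptional graphs *)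

(** Necessary for the distance matrix of a graph of diameter 3: some distance is 3, and from x to a
    point at distance a > 1 there is a first step to a neighbour of x at distance a - 1 from that
    point. *)
Definition geodesic (M : seq (seq nat)) : bool :=
  has (has (pred1 3)) M &&
  all (fun r => all2b (fun a s =>
    (a <= 1) || has id (map2 (fun b c => (b == 1) && (c == a.-1)) r s)) r M) M.

Section Presentation.
Variables (m : nat) (e : rel nat).
(** The value 3 stands for every distance above 2, as in [dist3]. *)
Definition pdist i j : nat :=
  if eqn i j then 0 else if e i j then 1
  else if has (fun k => e i k && e k j) (iota 0 m) then 2 else 3.
Fixpoint pcode (o : seq nat) : seq (seq nat) :=
  if o is i :: o then [seq pdist i j | j <- o] :: pcode o else [::].
(** The ordering heuristic of [canon], so that membership in [targets] can be tested by equality of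
    codes. *)
Definition porder : seq nat := canon_order [seq [seq pdist i j | j <- iota 0 m]
  | i <- iota 0 m].
End Presentation.

(* The exceptional graphs as relations on 0, ..., m - 1. *)
Definition edge_list_pres (s : seq (nat * nat)) : rel nat :=
  fun i j => (i != j) && (((i.+1, j.+1) \in s) || ((j.+1, i.+1) \in s)).
Definition M_pres p (ps : seq nat) : rel nat := fun i j =>
  match i < p, j < p with
  | true, true => i != j
  | true, false => i == j - p
  | false, true => j == i - p
  | false, false => (i != j) && (reshape_index ps (i - p) == reshape_index ps (j - p))
  end.
Definition M'_pres p : rel nat := fun i j =>
  match i < p, j < p with
  | true, false => (i == j - p) && (i < p.-1)
  | false, true => (j == i - p) && (j < p.-1)
  | _, _ => i != j
  end.

Definition presentations : seq (nat * rel nat) :=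
  [:: (5, edge_list_pres [:: (1,2); (1,3); (2,4); (3,4); (4,5)]);
      (5, edge_list_pres [:: (1,2); (1,3); (2,3); (2,4); (3,4); (4,5)]);
      (5, edge_list_pres [:: (1,2); (1,3); (2,3); (3,4); (4,5)]);
      (5, edge_list_pres [:: (1,2); (1,3); (1,4); (4,5)]);
      (4, M_pres 2 [:: 1; 1]); (5, M_pres 3 [:: 1; 1]);
      (6, M_pres 3 [:: 1; 1; 1]); (6, M_pres 3 [:: 2; 1]);
      (8, M_pres 4 [:: 1; 1; 1; 1]); (8, M_pres 4 [:: 2; 1; 1]);
      (8, M_pres 4 [:: 2; 2]); (8, M_pres 4 [:: 3; 1]);
      (6, M'_pres 3); (8, M'_pres 4)].

Definition targets := [seq pcode p.1 p.2 (porder p.1 p.2) | p <- presentations].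

Definition good (c : seq (seq nat)) : bool :=
  if size c <= 8 then
    at_most (size c).-1 c && geodesic (full_matrix c) ==> (c \in targets)
  else ~~ at_most (size c).-1 c.

(** From [seeds], level k has k + 2 points. The bound of 10 lines is chosen for 11 points: if level
    8 is empty, then 10 points always have at least 11 lines. *)
Fixpoint sweep n Rs : bool :=
  all good Rs && (if n is n'.+1 then sweep n' (grow 10 Rs) else nilp Rs).

Lemma sweep_ok : sweep 8 seeds.
Proof. by vm_compute. Qed.

Lemma sweepP n k Rs : sweep n Rs -> k <= n -> all good (iter k (grow 10) Rs).
Proof.
elim: n k Rs => [|n IH] [|k] Rs //= /andP[g h] kn //.
by rewrite -iterS iterSr; apply: IH.
Qed.

Lemma sweep_nil n Rs : sweep n Rs -> iter n (grow 10) Rs = [::].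
Proof.
elim: n Rs => [|n IH] Rs /= /andP[_ h]; first exact/nilP.
by rewrite -iterS iterSr; apply: IH.
Qed.

(** * At least as many lines as points from 9 points on *)

Section Nine.
Variables (T : finType) (d : T -> T -> nat).
Hypothesis d_metric : metric3 d.

Lemma subset_listing (A : {set T}) k : k <= #|A| ->
  exists t, [/\ uniq t, size t = k & [set x in t] \subset A].
Proof.
move=> kA; exists (take k (enum A)); split.
- by rewrite take_uniq ?enum_uniq.
- by rewrite size_take -cardE; case: ltngtP kA.
by apply/subsetP => x; rewrite inE => /mem_take; rewrite mem_enum.
Qed.

Lemma good_code k t : uniq t -> size t = k.+2 -> k <= 8 -> #|lns d [set x in t]| <= 10 ->
  exists2 t', perm_eq t' t & good (code d t').
Proof.
move=> ut st k8 few; have [t' pt' c] := enumerated d_metric ut st few.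
by exists t' => //; apply: (allP (sweepP sweep_ok k8)).
Qed.

Theorem many_lines (A : {set T}) : 9 <= #|A| -> #|A| <= #|lns d A|.
Proof.
have [n] := ubnP #|A|; elim: n A => // n IHn A An A9.
have [A12|A11] := leqP 12 #|A|.
  rewrite leqNgt; apply/negP => few.
  apply: (no_counterexample d_metric A12 few) => B BA B9; apply: IHn => //; lia.
(* With 10 or 11 points, a subspace of 10 points already has more than 10 lines. *)
have [A10|A9'] := leqP 10 #|A|.
  have [t [ut st tA]] := subset_listing A10.
  have : 10 < #|lns d [set x in t]|; last by move: (lns_sub d tA); lia.
  rewrite ltnNge; apply/negP => few;
    have [t' _] := enumerated d_metric ut (st : _ = 8.+2) few.
  by rewrite (sweep_nil sweep_ok).
have [t [ut st tA]] := subset_listing A9.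
apply: leq_trans (lns_sub d tA); rewrite leqNgt; apply/negP => few.
have few10 : #|lns d [set x in t]| <= 10 by lia.
have [t' pt'] := good_code ut (st : _ = 7.+2) isT few10.
have ut' : uniq t' by rewrite (perm_uniq pt').
have st' : size (code d t') = 9.
  by rewrite -st -(perm_size pt'); elim: (t') => //= x s ->.
rewrite /good st' /= at_mostE // => /negP[].
rewrite (_ : [set x in t'] = [set x in t]); first by lia.
by apply/setP => x; rewrite !inE (perm_mem pt').
Qed.

End Nine.

(** * Distances in graphs of diameter 3 *)

Section GraphDistance.
Variable G : sgraph.
Implicit Types x y z : G.

(** The graph distance capped at 3; [dist_dist3] identifies it with [dist] for diameter 3. *)
Definition dist3 x y : nat :=
  if x == y then 0 else if edge x y then 1
  else if [exists z, edge x z && edge z y] then 2 else 3.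

Lemma edge_neq x y : edge x y -> x != y.
Proof. by apply: contraTneq => ->; rewrite edge_irrefl. Qed.

Lemma dist3_eq1 x y : (dist3 x y == 1) = edge x y.
Proof.
rewrite /dist3; case: (eqVneq x y) => [->|_]; first by rewrite edge_irrefl.
by case: (edge x y) => //; case: ifP.
Qed.

Lemma dist3_metric : metric3 dist3.
Proof.
have sym x y : dist3 x y = dist3 y x.
  rewrite /dist3 eq_sym edge_sym; do 2!case: ifP => // _.
  by congr (if _ then _ else _); apply: eq_existsb => z; rewrite andbC ![edge z _]edge_sym.
have path2 x y z : dist3 x y = 1 -> dist3 y z = 1 -> dist3 x z != 3.
  move=> /eqP + /eqP; rewrite !dist3_eq1 => xy yz; rewrite /dist3.
  have -> : [exists w, edge x w && edge w z] by apply/existsP; exists y; rewrite xy.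
  by case: (x == z); case: (edge x z).
split=> // [x|x y xy|x y z].
- by rewrite /dist3 eqxx.
- by rewrite /dist3 (negPf xy); case: (edge x y); case: ([exists z, edge x z && edge z y]).
move: (path2 y x z) (path2 x y z) (path2 x z y); rewrite (sym y x) (sym z y).
by case: (dist3 x y) (dist3 x z) (dist3 y z) =>
  [|[|[|[|a]]]] [|[|[|[|b]]]] [|[|[|[|c]]]] //;
  do ?[by move=> /(_ erefl erefl) | move=> _].
Qed.

Lemma has_path0 x y : has_path x y 0 = (x == y).
Proof.
apply/existsP/idP => [[p] | /eqP->]; first by rewrite tuple0.
by exists [tuple]; rewrite /= eqxx.
Qed.

Lemma has_path1 x y : has_path x y 1 = edge x y.
Proof.
apply/existsP/idP => [[p]|xy].
  by case/tupleP: p => z p; rewrite tuple0 /= andbT => /and3P[xz _ /eqP <-].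
by exists [tuple y]; rewrite /= xy inE edge_neq /=.
Qed.

Lemma has_path2 x y : x != y -> has_path x y 2 = [exists z, edge x z && edge z y].
Proof.
move=> xy; apply/existsP/existsP => [[p]|[z /andP[xz zy]]].
  case/tupleP: p => z p; case/tupleP: p => w p; rewrite tuple0 /= !andbT.
  by case/and3P=> [/andP[xz zw] _ /eqP <-]; exists z; rewrite xz.
exists [tuple z; y]; rewrite /= xz zy !inE negb_or (edge_neq xz) xy (edge_neq zy) /=.
by rewrite eqxx.
Qed.

Lemma has_path_size x y n : has_path x y n -> n < #|G|.
Proof.
case/existsP=> p /and3P[_ up _]; rewrite -[n](size_tuple p) -[_.+1]/(size (x :: p)).
by rewrite -(card_uniqP up) max_card.
Qed.

Lemma dist_le x y n : has_path x y n -> dist x y <= n.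
Proof.
move=> h; rewrite leqNgt; apply/negP => lt; have := before_find 0 lt.
by rewrite nth_iota ?add0n ?h // (has_path_size h).
Qed.

Lemma dist_path x y : dist x y < #|G| -> has_path x y (dist x y).
Proof.
move=> lt; have h : has (has_path x y) (iota 0 #|G|) by rewrite has_find size_iota.
by have := nth_find 0 h; rewrite nth_iota.
Qed.

Hypothesis diam3 : has_diameter G 3.

Lemma dist_lt x y : dist x y < #|G|.
Proof.
have [/(_ x y)/connectP[p xp ->] _] := diam3.
case/shortenP: xp => q xq uq _.
have h : has_path x (last x q) (size q).
  by apply/existsP; exists (in_tuple q); apply/and3P; split.
exact: leq_ltn_trans (dist_le h) (has_path_size h).
Qed.

Lemma dist_le3 x y : dist x y <= 3.
Proof.
have [_ <-] := diam3.
exact: leq_trans (leq_bigmax_cond _ _) (leq_bigmax_cond (F := fun x =>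
  \max_y dist x y) _ _).
Qed.

Lemma dist_dist3 x y : dist x y = dist3 x y.
Proof.
have h := dist_path (dist_lt x y); have l3 := dist_le3 x y; rewrite /dist3.
case: (eqVneq x y) => [e|xy].
  by apply/eqP; rewrite -leqn0; apply: dist_le; rewrite has_path0 e.
have d0 : dist x y != 0 by apply: contraNneq xy => e; rewrite -has_path0 -e.
case: ifP => [xy1|/negbT nxy].
  by have : dist x y <= 1 by [apply: dist_le; rewrite has_path1]; lia.
have d1 : dist x y != 1 by apply: contraNneq nxy => e; rewrite -has_path1 -e.
case: ifP => [xy2|/negbT nxy2].
  by have : dist x y <= 2 by [apply: dist_le; rewrite has_path2]; lia.
have d2 : dist x y != 2 by apply: contraNneq nxy2 => e; rewrite -has_path2 // -e.
lia.
Qed.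

Lemma mem_line x y z : x != y ->
  (z \in line x y) = (z \in ln dist3 x y).
Proof.
move=> xy; have [d0 dC d13 _] := dist3_metric.
rewrite in_ln /line !inE /between !dist_dist3.
have [->|zx] := eqVneq z x; first by rewrite d0; have := d13 _ _ xy;
  rewrite !inE => /or3P[] /eqP->.
have [->|zy] := eqVneq z y.
  by rewrite d0 dC orbT; have := d13 _ _ xy; rewrite dC !inE => /or3P[] /eqP->.
rewrite ?(eq_sym y z) ?(eq_sym x z) ?zx ?zy ?xy /= ?(dC y z) ?(dC x z).
have := d13 _ _ xy; have := d13 _ _ zx; have := d13 _ _ zy; rewrite !inE.
by do 3![case/or3P=> /eqP->].
Qed.

Lemma linesE : lines G = lns dist3 [set: G].
Proof.
apply/setP => L; apply/imsetP/imsetP => -[p pP ->]; exists p; move: pP; rewrite !inE //=;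
  by move=> p12; apply/setP => z; rewrite /trl setIT mem_line.
Qed.

Lemma exists_dist3 : exists x y, dist3 x y = 3.
Proof.
have [_ m3] := diam3; have G0 : 0 < #|G|.
  (* Without vertices the maximum would be 0. *)
  rewrite lt0n; apply: contra_eq_neq m3 => /eqP; rewrite -cardsT cards_eq0 => /eqP G0.
  by rewrite big_pred0 // => x; have := in_setT x; rewrite G0 inE.
have [x xE] := bigop.eq_bigmax (fun x : G => \max_y dist x y) G0.
have [y yE] := bigop.eq_bigmax (fun y : G => dist x y) G0.
by exists x, y; rewrite -dist_dist3 -yE -xE.
Qed.

Lemma geodesic_code t : (forall x, x \in t) -> geodesic (full_matrix (code dist3 t)).
Proof.
move=> tG; have [d0 dC d13 _] := dist3_metric.
rewrite (full_matrixE dist3_metric) /geodesic; apply/andP; split.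
  have [x [y xy]] := exists_dist3.
  apply/hasP; exists (map (dist3 x) t); first by apply: map_f.
  by apply/hasP; exists 3 => //=; rewrite -xy map_f.
apply/allP => r /mapP[x _ ->]; rewrite all2b_map; apply/allP => y _ /=.
rewrite leqNgt; case: ltnP => //= d1.
rewrite map2_map has_map; apply/hasP.
have xy : x != y by apply: contraTneq d1 => ->; rewrite d0.
have n1 : ~~ edge x y by rewrite -dist3_eq1; lia.
have [/existsP[z /andP[xz zy]]|n2] := boolP [exists z, edge x z && edge z y].
  exists z => //=; rewrite dist3_eq1 xz dC.
  have -> : dist3 x y = 2.
    by rewrite /dist3 (negPf xy) (negPf n1); case: ifP => // /existsP[]; exists z;
      rewrite xz.
  by rewrite dist3_eq1.
have d3 : dist3 x y = 3 by rewrite /dist3 (negPf xy) (negPf n1) (negPf n2).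
(* At distance 3, the first inner vertex z of a shortest path is at distance 2 from y. *)
have := dist_path (dist_lt x y); rewrite dist_dist3 d3 => /existsP[p].
case/tupleP: p => z p; case/tupleP: p => w p; case/tupleP: p => v p;
  rewrite tuple0 /= !andbT.
case/and3P=> [/and3P[xz zw wv] _ /eqP ev]; rewrite {v}ev in wv.
exists z => //=; rewrite dist3_eq1 xz /= dC /dist3 eq_sym.
have zy : z != y by apply: contraNneq n1 => <-.
rewrite (negPf zy); have -> : edge z y = false.
  by apply: contraNF n2 => zy1; apply/existsP; exists z; rewrite xz.
by case: ifP => // /existsP[]; exists w; rewrite zw.
Qed.

End GraphDistance.

(** * Identification of the exceptional graphs *)

(** A numbering of the vertices by 0, ..., m - 1 that reduces questions about G to computations with
    e. *)
Definition presented (G : sgraph) m (e : rel nat) (ix : G -> nat) :=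
  [/\ injective ix, forall x, ix x < m, #|G| = m & forall x y, edge x y = e (ix x) (ix y)].

Lemma presented_onto (G : sgraph) m e (ix : G -> nat) i :
  presented m e ix -> i < m -> exists x, ix x = i.
Proof.
case=> inj lt card _ im; pose f x := Ordinal (lt x).
have finj : injective f by move=> x y [/inj].
have : Ordinal im \in codom f by apply: inj_card_onto finj _ _; rewrite card_ord card.
by case/codomP => x [->]; exists x.
Qed.

Lemma presented_isomorphic (G H : sgraph) m e (ix : H -> nat) :
  presented m e ix -> isomorphic G H -> exists ix' : G -> nat, presented m e ix'.
Proof.
case=> inj lt card ed [f fb fe]; exists (ix \o f); split=> [|x||x y] //=.
- exact: inj_comp inj (bij_inj fb).
- by rewrite (bij_eq_card fb).
by rewrite -fe ed.
Qed.

Lemma presented_dist (G : sgraph) m e (ix : G -> nat) x y :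
  presented m e ix -> dist3 x y = pdist m e (ix x) (ix y).
Proof.
move=> pr; have [inj lt card ed] := pr;
  rewrite /dist3 /pdist ed -[eqn _ _]/(ix x == ix y) (inj_eq inj).
suff -> : [exists z, edge x z && edge z y] = has (fun k =>
  e (ix x) k && e k (ix y)) (iota 0 m) by [].
apply/existsP/hasP => [[z]|[k]].
  by rewrite !ed => h; exists (ix z) => //; rewrite mem_iota lt.
by rewrite mem_iota => /(presented_onto pr)[z <-] h; exists z; rewrite !ed.
Qed.

Lemma code_pcode (G : sgraph) m e (ix : G -> nat) t :
  presented m e ix -> code (@dist3 G) t = pcode m e (map ix t).
Proof.
move=> pr; elim: t => //= x t ->; congr (_ :: _).
by rewrite -map_comp; apply: eq_map => y /=; apply: presented_dist.
Qed.

Lemma presented_few (G : sgraph) m e (ix : G -> nat) :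
  has_diameter G 3 -> presented m e ix -> 0 < m ->
  at_most m.-1 (pcode m e (iota 0 m)) -> #|lines G| < #|G|.
Proof.
move=> diam pr m0; have [inj lt card ed] := pr.
have [t tE] : exists t, map ix t = iota 0 m.
  have : all (ltn^~ m) (iota 0 m) by apply/allP => i; rewrite mem_iota.
  elim: (iota 0 m) => [|i s IH] /=; first by exists [::].
  case/andP=> im /IH[t <-]; have [x <-] := presented_onto pr im.
  by exists (x :: t).
have ut : uniq t by rewrite -(map_inj_uniq inj) tE iota_uniq.
rewrite -tE -(code_pcode _ pr) (at_mostE (@dist3_metric G)) // linesE // card.
have -> : [set x in t] = [set: G]; last by rewrite -ltnS prednK.
by apply/setP=> x; rewrite !inE -(mem_map inj) tE mem_iota lt.
Qed.

Lemma code_nth (T : finType) (d : T -> T -> nat) m e x0 (t : seq T) o a b :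
  code d t = pcode m e o -> a < b -> b < size t ->
  d (nth x0 t a) (nth x0 t b) = pdist m e (nth 0 o a) (nth 0 o b).
Proof.
elim: t o a b => [|x t IH] [|i o] a b //= [e1 e2]; case: b => // b;
  case: a => [|a] /= ab bt.
  have /(congr1 (fun s => nth 0 s b)) := e1; have so : size o = size t.
    by have /(congr1 size) := e1; rewrite !size_map.
  by rewrite (nth_map x0) // (nth_map 0) ?so.
exact: IH.
Qed.

(** Send the k-th vertex of t to the vertex of H numbered by the k-th entry of o. Equal codes give
    equal distances, and adjacency is distance 1. *)
Lemma isomorphic_of_code (G H : sgraph) m e (ix : H -> nat) (t : seq G) o :
  presented m e ix -> uniq t -> (forall x, x \in t) -> size t = m ->
  perm_eq o (iota 0 m) -> code (@dist3 G) t = pcode m e o -> isomorphic G H.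
Proof.
move=> pr ut tG st po ct; have [inj lt card ed] := pr.
have uo : uniq o by rewrite (perm_uniq po) iota_uniq.
have so : size o = size t by rewrite (perm_size po) size_iota.
have it x : index x t < size t by rewrite index_mem.
have olt x : nth 0 o (index x t) < m.
  by have : nth 0 o (index x t) \in o by [rewrite mem_nth ?so];
    rewrite (perm_mem po) mem_iota.
have [f fE] := fin_all_exists (fun x => presented_onto pr (olt x)).
have finj : injective f.
  move=> x y /(congr1 ix)/eqP; rewrite !fE nth_uniq ?so // => /eqP e'.
  by rewrite -(nth_index x (tG x)) e' nth_index.
exists f.
  by apply: inj_card_bij finj _; rewrite card -st -(card_uniqP ut) subset_leq_card //;
    apply/subsetP.
have main x y : index x t < index y t -> edge (f x) (f y) = edge x y.
  move=> xy; have := code_nth x ct xy (it y); rewrite !nth_index // => dE.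
  rewrite -(dist3_eq1 x y) dE -!fE -(presented_dist _ _ pr); by rewrite dist3_eq1.
move=> x y; case: (ltngtP (index x t) (index y t)) => [|lt'|e']; first exact: main.
  by rewrite edge_sym main // edge_sym.
have <- : x = y by rewrite -(nth_index x (tG x)) e' nth_index.
by rewrite !edge_irrefl.
Qed.

(** * Numberings of the vertices of the exceptional graphs *)

Lemma edge_list_presented n s : presented n (edge_list_pres s) (val : edge_list_graph n s
  -> nat).
Proof.
split=> [|x||x y]; [exact: val_inj | exact: ltn_ord | exact: card_ord |].
by rewrite /= /edge_list_rel /edge_list_pres -val_eqE.
Qed.

Definition M'_index p (x : M' p) : nat := match x with inl a => a | inr a => p + a end.

Lemma M'_presented p : presented (p + p) (M'_pres p) (@M'_index p).
Proof.
split=> [|[a|a]||].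
- move=> [a|a] [b|b] /= e; first by congr inl; apply: val_inj.
  + by have := ltn_ord a; rewrite e ltnNge leq_addr.
  + by have := ltn_ord b; rewrite -e ltnNge leq_addr.
  by congr inr; apply: val_inj; apply: (@addnI p).
- by rewrite /= ltn_addr.
- by rewrite /= ltn_add2l.
- by rewrite card_sum card_ord.
by move=> [a|a] [b|b] /=; rewrite /M'_pres ?ltn_ord ?ltnNge ?leq_addr /= ?addKn
  ?eqn_add2l //;
  rewrite -leqNgt leq_addr.
Qed.

(** In this numbering the matching joins a with p + a. *)
Definition M_index p ps (x : M p ps) : nat :=
  match x with inl a => a | inr u => p + flatten_index ps (tag u) (tagged u) end.

Lemma flatten_index_inj (ps : seq nat) (u v : {i : 'I_(size ps) & 'I_(nth 0 ps i)}) :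
  flatten_index ps (tag u) (tagged u) = flatten_index ps (tag v) (tagged v) -> u = v.
Proof.
case: u v => [i a] [j b] /= e.
have /val_inj ij : i = j :> nat.
  by rewrite -(flatten_indexKl (ltn_ord a)) e flatten_indexKl ?ltn_ord.
case: j / ij b e => b e; congr Tagged; apply: val_inj => /=.
by rewrite -(flatten_indexKr (ltn_ord a)) e flatten_indexKr ?ltn_ord.
Qed.

Lemma M_presented p ps : presented (p + sumn ps) (M_pres p ps) (@M_index p ps).
Proof.
split=> [|x||x y].
- move=> [a|u] [b|v] /= e; first by congr inl; apply: val_inj.
  + by have := ltn_ord a; rewrite e ltnNge leq_addr.
  + by have := ltn_ord b; rewrite -e ltnNge leq_addr.
  by congr inr; apply: flatten_index_inj; apply: (@addnI p).
- case: x => [a|[i a]] /=; first exact: ltn_addr.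
  by rewrite ltn_add2l flatten_indexP.
- rewrite card_sum card_ord card_tagged; congr (_ + sumn _).
  rewrite -[RHS](mkseq_nth 0) /mkseq -val_enum_ord -map_comp.
  by apply: eq_map => i /=; rewrite card_ord.
case: x y => [a|u] [b|v]; rewrite /= /M_pres ?ltn_ord ?[_ + _ < _]ltnNge ?leq_addr //=
  ?addKn //.
rewrite !flatten_indexKl ?ltn_ord // andbC eqn_add2l; congr (~~ _ && _).
by apply/eqP/eqP => [->//|]; apply: flatten_index_inj.
Qed.

(** * The classification *)

Definition listed (G : sgraph) (c : seq (seq nat)) : Prop :=
  exists t : seq G, [/\ uniq t, forall x, x \in t & code (@dist3 G) t = c].

Lemma target_isomorphic (G H : sgraph) m e (ix : H -> nat) : presented m e ix ->
  perm_eq (porder m e) (iota 0 m) -> listed G (pcode m e (porder m e)) -> isomorphic G H.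
Proof.
move=> pr po [t [ut tG ct]]; apply: (isomorphic_of_code pr ut tG _ po ct).
have sc o : size (pcode m e o) = size o by elim: o => //= i o ->.
have sd s : size (code (@dist3 G) s) = size s by elim: s => //= x s ->.
by rewrite -sd ct sc (perm_size po) size_iota.
Qed.

(** By [many_lines] there are at most 8 vertices, and a distance 3 needs at least 4; the enumeration
    does the rest. *)
Lemma few_lines_listed (G : sgraph) : has_diameter G 3 -> #|lines G| < #|G| ->
  exists2 c, c \in targets & listed G c.
Proof.
move=> diam few; rewrite linesE // -[#|G|]cardsT in few.
have metric := dist3_metric G.
have G8 : #|[set: G]| <= 8.
  by rewrite leqNgt; apply/negP => /(many_lines metric); rewrite leqNgt few.
have G4 : 3 < #|[set: G]|.
  by have [x [y xy]] := exists_dist3 diam; rewrite cardsT -xy -dist_dist3 // dist_lt.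
have sG : size (enum G) = (#|[set: G]| - 2).+2.
  rewrite -cardE -cardsT; move: G4; move: #|[set: G]| => k; lia.
have EG : [set x in enum G] = [set: G] by apply/setP => x; rewrite !inE mem_enum.
have [||t pt] := good_code metric (enum_uniq G) sG; first by lia.
  by rewrite EG; lia.
have ut : uniq t by rewrite (perm_uniq pt) enum_uniq.
have tG x : x \in t by rewrite (perm_mem pt) mem_enum.
have st : size (code (@dist3 G) t) = #|[set: G]|.
  by rewrite cardsT cardE -(perm_size pt); elim: (t) => //= x s ->.
have Et : [set x in t] = [set: G] by apply/setP => x; rewrite !inE tG.
rewrite /good st G8 at_mostE // Et geodesic_code // andbT => /implyP h.
exists (code (@dist3 G) t); last by exists t.
by apply: h; move: few; lia.
Qed.

Theorem theorem2p1 (G : sgraph) (hdiam : has_diameter G 3) :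
  #|lines G| < #|G| <->
  isomorphic G Ga \/ isomorphic G Gb \/ isomorphic G Gc \/ isomorphic G Gd \/
  isomorphic G (M 2 [:: 1; 1]) \/
  isomorphic G (M 3 [:: 1; 1]) \/
  isomorphic G (M 3 [:: 1; 1; 1]) \/
  isomorphic G (M 3 [:: 2; 1]) \/
  isomorphic G (M 4 [:: 1; 1; 1; 1]) \/
  isomorphic G (M 4 [:: 2; 1; 1]) \/
  isomorphic G (M 4 [:: 2; 2]) \/
  isomorphic G (M 4 [:: 3; 1]) \/
  isomorphic G (M' 3) \/
  isomorphic G (M' 4).
Proof.
split=> [few|].
  (* For each target, evaluation confirms that [porder] lists every vertex exactly once. *)
  have [c] := few_lines_listed hdiam few.
  rewrite /targets /presentations !map_cons !inE.
  case/orP=> [/eqP-> l|]; first by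
    left; apply: (target_isomorphic (edge_list_presented _ _) _ l); vm_compute.
  case/orP=> [/eqP-> l|]; first by
    right; left; apply: (target_isomorphic (edge_list_presented _ _) _ l); vm_compute.
  case/orP=> [/eqP-> l|]; first by
    do 2 right; left; apply: (target_isomorphic (edge_list_presented _ _) _ l); vm_compute.
  case/orP=> [/eqP-> l|]; first by
    do 3 right; left; apply: (target_isomorphic (edge_list_presented _ _) _ l); vm_compute.
  case/orP=> [/eqP-> l|]; first by
    do 4 right; left; apply: (target_isomorphic (M_presented 2 [:: 1; 1]) _ l); vm_compute.
  case/orP=> [/eqP-> l|]; first by
    do 5 right; left; apply: (target_isomorphic (M_presented 3 [:: 1; 1]) _ l); vm_compute.
  case/orP=> [/eqP-> l|]; first by
    do 6 right; left; apply: (target_isomorphic (M_presented 3 [:: 1; 1; 1]) _ l);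
      vm_compute.
  case/orP=> [/eqP-> l|]; first by
    do 7 right; left; apply: (target_isomorphic (M_presented 3 [:: 2; 1]) _ l); vm_compute.
  case/orP=> [/eqP-> l|]; first by
    do 8 right; left; apply: (target_isomorphic (M_presented 4 [:: 1; 1; 1; 1]) _ l);
      vm_compute.
  case/orP=> [/eqP-> l|]; first by
    do 9 right; left; apply: (target_isomorphic (M_presented 4 [:: 2; 1; 1]) _ l);
      vm_compute.
  case/orP=> [/eqP-> l|]; first by
    do 10 right; left; apply: (target_isomorphic (M_presented 4 [:: 2; 2]) _ l); vm_compute.
  case/orP=> [/eqP-> l|]; first by
    do 11 right; left; apply: (target_isomorphic (M_presented 4 [:: 3; 1]) _ l); vm_compute.
  case/orP=> [/eqP-> l|]; first by
    do 12 right; left; apply: (target_isomorphic (M'_presented 3) _ l); vm_compute.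
  by move/eqP-> => l;
    do 13 right; apply: (target_isomorphic (M'_presented 4) _ l); vm_compute.
(* Conversely, the lines of each graph are counted by evaluation on its presentation. *)
case=> [/(presented_isomorphic (edge_list_presented _ _))[ix pr]|];
  first by apply: (presented_few hdiam pr); vm_compute.
case=> [/(presented_isomorphic (edge_list_presented _ _))[ix pr]|];
  first by apply: (presented_few hdiam pr); vm_compute.
case=> [/(presented_isomorphic (edge_list_presented _ _))[ix pr]|];
  first by apply: (presented_few hdiam pr); vm_compute.
case=> [/(presented_isomorphic (edge_list_presented _ _))[ix pr]|];
  first by apply: (presented_few hdiam pr); vm_compute.
case=> [/(presented_isomorphic (M_presented 2 [:: 1; 1]))[ix pr]|];
  first by apply: (presented_few hdiam pr); vm_compute.
case=> [/(presented_isomorphic (M_presented 3 [:: 1; 1]))[ix pr]|];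
  first by apply: (presented_few hdiam pr); vm_compute.
case=> [/(presented_isomorphic (M_presented 3 [:: 1; 1; 1]))[ix pr]|];
  first by apply: (presented_few hdiam pr); vm_compute.
case=> [/(presented_isomorphic (M_presented 3 [:: 2; 1]))[ix pr]|];
  first by apply: (presented_few hdiam pr); vm_compute.
case=> [/(presented_isomorphic (M_presented 4 [:: 1; 1; 1; 1]))[ix pr]|];
  first by apply: (presented_few hdiam pr); vm_compute.
case=> [/(presented_isomorphic (M_presented 4 [:: 2; 1; 1]))[ix pr]|];
  first by apply: (presented_few hdiam pr); vm_compute.
case=> [/(presented_isomorphic (M_presented 4 [:: 2; 2]))[ix pr]|];
  first by apply: (presented_few hdiam pr); vm_compute.
case=> [/(presented_isomorphic (M_presented 4 [:: 3; 1]))[ix pr]|];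
  first by apply: (presented_few hdiam pr); vm_compute.
case=> [/(presented_isomorphic (M'_presented 3))[ix pr]|];
  first by apply: (presented_few hdiam pr); vm_compute.
by move=> /(presented_isomorphic (M'_presented 4))[ix pr];
  apply: (presented_few hdiam pr); vm_compute.
Qed.
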